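(* Assume that $H$ is coercive, i.e. $\lim_{|p|\to\infty}\min_{x\in\mathbb T^n}H_i(x,p)=\infty$ for every $i\in\mathbb I$, and that $B$ is a constant (independent of $x\in\mathbb T^n$) monotone matrix. Then the ergodic problem $Bv+H[v]=c$ in $\mathbb T^n$ has a solution $(c,v)\in\mathbb R^m\times C(\mathbb T^n)^m$, i.e. there exist $c\in\mathbb R^m$ and $v\in C(\mathbb T^n)^m$ such that $v$ is a solution of $Bv+H[v]=c$ in $\mathbb T^n$.
   Context: Let $m,n\in\mathbb N$, $\mathbb I=\{1,\dots,m\}$, let $\mathbb T^n$ be the $n$-dimensional flat torus, $\Xi$ a (nonempty) compact metric space, $g=(g_i)_{i\in\mathbb I}\in C(\mathbb T^n\times\Xi,\mathbb R^n)^m$ and $L=(L_i)_{i\in\mathbb I}\in C(\mathbb T^n\times\Xi)^m$. The Hamiltonian $H=(H_i)_{i\in\mathbb I}$ is given by $H_i(x,p)=\max_{\xi\in\Xi}[-g_i(x,\xi)\cdot p-L_i(x,\xi)]$ for $(x,p)\in\mathbb T^n\times\mathbb R^n$. Here $B=(b_{ij})_{i,j\in\mathbb I}$ is a real $m\times m$ matrix acting by $(Bu)_i(x)=\sum_{j\in\mathbb I}b_{ij}u_j(x)$. $H[u]$ stands for $(H_i(x,Du_i(x)))_{i\in\mathbb I}$. Monotone matrix: a real $m\times m$ matrix $A$ is monotone if whenever $u\in\mathbb R^m$ and $u_k=\max_{i\in\mathbb I}u_i\ge0$, then $(Au)_k\ge0$. Solutions are viscosity solutions: for $c\in\mathbb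 R^m$, $u\in C(\mathbb T^n)^m$ is a subsolution (resp. supersolution) of $Bu+H[u]=c$ in $\mathbb T^n$ if for every $i\in\mathbb I$, $\psi\in C^1(\mathbb T^n)$ and every maximum (resp. minimum) point $x$ of $u_i-\psi$, one has $(Bu)_i(x)+H_i(x,D\psi(x))\le c_i$ (resp. $\ge c_i$); a solution is both. *)

(* Defs.v *)
From HB Require Import structures.
From mathcomp Require Import all_boot all_order all_algebra.
From mathcomp Require Import all_classical all_reals topology normedtype derive trigo.

Set Implicit Arguments.
Unset Strict Implicit.
Unset Printing Implicit Defensive.
Import Order.TTheory GRing.Theory Num.Theory.
Import numFieldNormedType.Exports.
Local Open Scope classical_set_scope.
Local Open Scope ring_scope.

(* The flat torus is R^n / Z^n: a point of it is given by a
   representative in 'rV[R]_n, and a function on it by the corresponding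
   Z^n-periodic function on 'rV[R]_n. *)

Section Torus.
Variables (R : realType) (n : nat).

Definition Zn_periodic (V : zmodType) (f : 'rV[R]_n -> V) : Prop :=
  forall z : 'rV[int]_n, periodic f (map_mx intr z).

Definition C_torus (f : 'rV[R]_n -> R) : Prop :=
  continuous f /\ Zn_periodic f.

Definition C_torus_prod (Xi : metricType R) (V : normedModType R)
    (f : 'rV[R]_n -> Xi -> V) : Prop :=
  continuous (uncurry f) /\ forall xi, Zn_periodic (f^~ xi).

Definition gradient (f : 'rV[R]_n -> R) (x : 'rV[R]_n) : 'rV[R]_n :=
  \row_k 'D_(delta_mx 0 k) f x.

Definition C1_torus (f : 'rV[R]_n -> R) : Prop :=
  [/\ Zn_periodic f, forall x, differentiable f x & continuous (gradient f)].

Definition dotp (p q : 'rV[R]_n) : R := \sum_k p 0 k * q 0 k.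

(* The library norm on 'rV[R]_n is the sup norm. *)
Definition enorm (p : 'rV[R]_n) : R := Num.sqrt (dotp p p).

End Torus.

(* When Xi is compact and nonempty and g, L are continuous, the set below is compact
   and nonempty, so this
   [sup] is a maximum: see [hamiltonian_max]. *)
Definition hamiltonian (R : realType) (m n : nat) (Xi : metricType R)
    (g : 'I_m -> 'rV[R]_n -> Xi -> 'rV[R]_n) (L : 'I_m -> 'rV[R]_n -> Xi -> R)
    (i : 'I_m) (x p : 'rV[R]_n) : R :=
  sup [set - dotp (g i x xi) p - L i x xi | xi in [set: Xi]].

Section System.
Variables (R : realType) (m n : nat).
Implicit Types (H : 'I_m -> 'rV[R]_n -> 'rV[R]_n -> R) (B : 'M[R]_m).
Implicit Types (c : 'cV[R]_m) (u : 'I_m -> 'rV[R]_n -> R).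

(* For the Hamiltonians above, the [inf] is a minimum: see [hamiltonian_min]. *)
Definition coercive H : Prop :=
  forall i (M : R), exists r : R, forall p,
    r < enorm p -> M < inf [set H i x p | x in [set: 'rV[R]_n]].

Definition monotone_mx B : Prop :=
  forall (u : 'cV[R]_m) k,
    (forall i, u i 0 <= u k 0) -> 0 <= u k 0 -> 0 <= (B *m u) k 0.

Definition coupling B u (i : 'I_m) (x : 'rV[R]_n) : R :=
  \sum_j B i j * u j x.

Definition viscosity_subsolution B H c u : Prop :=
  (forall i, C_torus (u i)) /\
  forall i psi x, C1_torus psi ->
    (forall y, u i y - psi y <= u i x - psi x) ->
    coupling B u i x + H i x (gradient psi x) <= c i 0.

Definition viscosity_supersolution B H c u : Prop :=
  (forall i, C_torus (u i)) /\
  forall i psi x, C1_torus psi ->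
    (forall y, u i x - psi x <= u i y - psi y) ->
    c i 0 <= coupling B u i x + H i x (gradient psi x).

Definition viscosity_solution B H c u : Prop :=
  viscosity_subsolution B H c u /\ viscosity_supersolution B H c u.

End System.

Section HamiltonianExtrema.
Variables (R : realType) (m n : nat) (Xi : metricType R).
Hypotheses (Xi_compact : compact [set: Xi]) (Xi_neq0 : [set: Xi] !=set0).
Variables (g : 'I_m -> 'rV[R]_n -> Xi -> 'rV[R]_n) (L : 'I_m -> 'rV[R]_n -> Xi -> R).
Hypotheses (g_cont : forall i, C_torus_prod (g i)).
Hypotheses (L_cont : forall i, C_torus_prod (L i)).
Implicit Types (i : 'I_m) (x p : 'rV[R]_n) (xi : Xi).

Let F i p (z : 'rV[R]_n * Xi) : R := - dotp (g i z.1 z.2) p - L i z.1 z.2.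

Let F_cont i p : continuous (F i p).
Proof.
have gc : continuous (fun z : 'rV[R]_n * Xi => g i z.1 z.2).
  have -> : (fun z => g i z.1 z.2) = uncurry (g i) by apply/funext => -[].
  exact: (g_cont i).1.
have Lc : continuous (fun z : 'rV[R]_n * Xi => L i z.1 z.2).
  have -> : (fun z => L i z.1 z.2) = uncurry (L i) by apply/funext => -[].
  exact: (L_cont i).1.
move=> z; apply: cvgB; last exact: Lc.
apply: cvgN; apply: (cvg_big add_continuous) => k _.
apply: cvgM; last exact: cvg_cst.
apply: (continuous_comp (gc z) (g := fun v : 'rV[R]_n => v 0 k)).
exact: coord_continuous.
Qed.

Lemma hamiltonian_max i x p : exists xi,
  hamiltonian g L i x p = - dotp (g i x xi) p - L i x xi /\
  forall xi', - dotp (g i x xi') p - L i x xi' <= hamiltonian g L i x p.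
Proof.
have Fx_cont : continuous (fun xi => F i p (x, xi)).
  move=> xi; apply: (@continuous_comp _ _ _ (pair x)); last exact: F_cont.
  exact: (cvg_pair (cvg_cst x) cvg_id).
have [xi _ Fxi] := compact_EVT_max Xi_neq0 Xi_compact
  (continuous_subspaceT Fx_cont).
have Hxi : hamiltonian g L i x p = F i p (x, xi).
  apply/eqP; rewrite eq_le; apply/andP; split.
    apply: ge_sup; first by exists (F i p (x, xi)), xi.
    by move=> _ [xi' _ <-]; apply: Fxi; rewrite inE.
  apply: ub_le_sup; last by exists xi.
  by exists (F i p (x, xi)) => _ [xi' _ <-]; apply: Fxi; rewrite inE.
by exists xi; split=> // xi'; rewrite Hxi; apply: Fxi; rewrite inE.
Qed.

Lemma hamiltonian_continuous i p : continuous (fun x => hamiltonian g L i x p).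
Proof.
move=> x; apply/(@cvgrPdist_le _ _ _ (nbhs x) (nbhs_filter x)) => e e0.
have Fnear : \forall y \near x,
    [set: Xi] `<=` (fun xi => `|F i p (x, xi) - F i p (y, xi)| <= e).
  apply: (iffLR (compact_near_coveringP _) Xi_compact _ (nbhs x)
    (fun y xi => `|F i p (x, xi) - F i p (y, xi)| <= e) (nbhs_filter x)) => xi _.
  have e20 : 0 < e / 2 by rewrite divr_gt0.
  have /cvgrPdist_le/(_ _ e20) [[U V]/= [Ux Vxi] UV] := @F_cont i p (x, xi).
  exists (V, U) => // -[xi' y] [/= Vxi' Uy].
  rewrite [e]splitr -(subrKA (F i p (x, xi))) (le_trans (ler_normD _ _))//.
  rewrite lerD//; last exact: (UV (y, xi')).
  by rewrite distrC; apply: (UV (x, xi')); split => //=; exact: nbhs_singleton.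
apply: filterS Fnear => y /(_ _ I) Fnear.
have [xi [Hx maxx]] := hamiltonian_max i x p.
have [eta [Hy maxy]] := hamiltonian_max i y p.
rewrite ler_norml; apply/andP; split.
  rewrite lerNl opprB Hy lerBlDr.
  have := Fnear eta; rewrite distrC => /(le_trans (ler_norm _)).
  by rewrite lerBlDr => /le_trans; apply; rewrite lerD2l maxx.
rewrite Hx lerBlDr.
have := Fnear xi; move=> /(le_trans (ler_norm _)).
by rewrite lerBlDr => /le_trans; apply; rewrite lerD2l maxy.
Qed.

Lemma hamiltonian_min i p : exists x,
  inf [set hamiltonian g L i y p | y in [set: 'rV[R]_n]] =
    hamiltonian g L i x p /\
  forall y, hamiltonian g L i x p <= hamiltonian g L i y p.
Proof.
pose H y := hamiltonian g L i y p.
pose Q := [set v : 'rV[R]_n | forall k, v ord0 k \in `[0, 1]].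
have Q_compact : compact Q.
  have := @rV_compact R n (fun=> `[0, 1]%classic) (fun=> @segment_compact _ 0 1).
  by [].
have Q0 : Q !=set0.
  by exists 0 => k /=; rewrite mxE in_itv/= lexx ler01.
have H_cont : continuous H by exact: hamiltonian_continuous.
have [x _ xmin] := compact_EVT_min Q0 Q_compact (continuous_subspaceT H_cont).
have H_per : Zn_periodic H.
  move=> z y; rewrite /H /hamiltonian; congr sup.
  by apply: eq_imagel => xi _; rewrite ((g_cont i).2 xi) ((L_cont i).2 xi).
have {}xmin y : H x <= H y.
  rewrite -[leRHS](H_per (\row_k (- Num.floor (y ord0 k)))); apply: xmin.
  rewrite inE => k /=; rewrite !mxE in_itv/= mulrNz subr_ge0 floor_le/=.
  by rewrite lerBlDl -intrD1 ltW// floorD1_gt.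
exists x; split=> //; apply/eqP; rewrite eq_le; apply/andP; split.
  by apply: ge_inf; [exists (H x) => _ [y _ <-]; exact: xmin|exists x].
by apply: lb_le_inf => [|_ [y _ <-]]; [exists (H x), x|exact: xmin].
Qed.

End HamiltonianExtrema.

(* Main.v *)
Require Import Defs.
From HB Require Import structures.
From mathcomp Require Import all_boot all_order all_algebra.
From mathcomp Require Import all_classical all_reals topology normedtype derive trigo.
From mathcomp Require Import realfun sequences.
From mathcomp Require Import ring lra.

(** The ergodic problem is obtained as a limit of the discounted problems
[lam v + B v + H[v] = 0] as [lam] tends to [0]. The vector [c] is free, so it is
enough to find solutions [v] of these problems that are equi-Lipschitz and whose
coupling terms [lam v + B v] are bounded, both uniformly in [lam]; then
[v - v(0)] and [lam v(0) + B v(0)] converge along an ultrafilter, the limits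
being the solution and [- c] ([vanishing_discount]).

For fixed [lam], a solution is constructed by Perron's method in a class of
subsolutions with prescribed Lipschitz constants [K i]. The supremum of the class
belongs to it ([perron_sup]). It is a supersolution at every point where it is
touched from below by a test function whose gradient is smaller than [K i], since
otherwise a small periodic bump could be glued to it ([perron_bump]). Elsewhere
the gradient is large, so by coercivity the supersolution inequality is automatic
as soon as the coupling term is bounded below.

The crux is therefore a lower bound for [lam v + B v], uniform in [lam]; an upper
bound is part of the definition of the class. It rests on an alternative for
monotone matrices ([null_vector_or_barrier]), proved with the limit of the
resolvents [lam (lam + B)^-1]: there is a nonnegative vector [z] such that for each
index [j] either [j] is recurrent, in that some nonnegative left null vector [q]
of [B] charges [j], or [(B z)_j >= 1]. For recurrent indices, contracting with [q]
kills [B] and leaves only the bounded term [lam v]. For the other ones, testing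
at the minimum points of each component bounds [lam + B] applied to the
oscillation of [v], and [z] is a barrier that bounds this oscillation
([discounted_solution]). *)

Set Implicit Arguments.
Unset Strict Implicit.
Unset Printing Implicit Defensive.
Import Order.TTheory GRing.Theory Num.Theory.
Import numFieldNormedType.Exports.
Local Open Scope classical_set_scope.
Local Open Scope ring_scope.

(** * Norms on row vectors *)

Lemma cvg_sumr (R : realType) (T : Type) (F : set_system T) (k : nat)
    (f : 'I_k -> T -> R) (a : 'I_k -> R) : Filter F ->
  (forall i, f i @ F --> a i) -> (fun x => \sum_i f i x) @ F --> \sum_i a i.
Proof.
by move=> FF fa; apply: (cvg_big add_continuous) => i _; exact: fa.
Qed.

Section Norms.
Context {R : realType} {n : nat}.
Implicit Types (x y v : 'rV[R]_n).

Lemma rV_norm_leP v r : 0 <= r ->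
  reflect (forall k, `|v 0 k| <= r) (`|v| <= r).
Proof.
move=> r0; have -> : `|v| = _ := mx_normrE v; apply: (iffP (bigmax_leP _ _ _ _)).
  by move=> [_ vr] k; exact: (vr (0, k)).
by move=> vr; split=> // -[i k] _ /=; rewrite (ord1 i).
Qed.

Lemma rV_norm_ltP v r : 0 < r ->
  reflect (forall k, `|v 0 k| < r) (`|v| < r).
Proof.
move=> r0; have -> : `|v| = _ := mx_normrE v; apply: (iffP (bigmax_ltP _ _ _ _)).
  by move=> [_ vr] k; exact: (vr (0, k)).
by move=> vr; split=> // -[i k] _ /=; rewrite (ord1 i).
Qed.

Lemma rV_coord_le_norm v k : `|v 0 k| <= `|v|.
Proof. by apply/(rV_norm_leP v). Qed.

Lemma coord_le_enorm v k : `|v 0 k| <= enorm v.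
Proof.
rewrite -sqrtr_sqr /enorm ler_sqrt ?sumr_ge0// => [|i _]; last first.
  by rewrite -expr2 sqr_ge0.
by rewrite /dotp (bigD1 k)//= expr2 lerDl sumr_ge0// => i _; rewrite -expr2 sqr_ge0.
Qed.

(** The norm dual to the sup norm of the row vectors: a function whose gradient
is bounded by [k] in this norm is [k]-Lipschitz for the sup norm. *)
Definition norm1 v : R := \sum_k `|v 0 k|.

Lemma norm1_le_enorm v : norm1 v <= n%:R * enorm v.
Proof.
rewrite (le_trans (ler_sum _ (fun k _ => coord_le_enorm v k)))//.
by rewrite sumr_const card_ord mulr_natl.
Qed.

Lemma dotp_le v w : dotp v w <= norm1 v * `|w|.
Proof.
rewrite /dotp /norm1 mulr_suml ler_sum// => k _.
by rewrite (le_trans (ler_norm _))// normrM ler_wpM2l// rV_coord_le_norm.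
Qed.

Lemma continuous_norm1 : continuous norm1.
Proof.
move=> v; apply: (cvg_sumr (nbhs_filter v)) => k.
exact: (continuous_comp (@coord_continuous _ _ _ 0 k v) (@norm_continuous _ _ _)).
Qed.

End Norms.

(** * Periodic functions *)

Section Torus.
Context {R : realType} {n : nat}.
Implicit Types (x y v : 'rV[R]_n) (f : 'rV[R]_n -> R) (z : 'rV[int]_n).

(** Every point has a translate in the unit cube centred at [x0]; periodicity
then reduces global statements to that cube, where [ripple x0] controls the
distance to [x0]. *)
Lemma near_lattice x0 y :
  exists z, `|y + map_mx intr z - x0| <= 2^-1.
Proof.
exists (\row_k (- Num.floor (y 0 k - x0 0 k + 2^-1))).
apply/rV_norm_leP; first by lra.
move=> k; rewrite !mxE mulrNz ler_norml.
have := floor_le (y 0 k - x0 0 k + 2^-1).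
have := floorD1_gt (y 0 k - x0 0 k + 2^-1).
rewrite intrD1; lra.
Qed.

Lemma C_torus_max f : C_torus f -> exists x, forall y, f y <= f x.
Proof.
move=> [fc fper].
pose Q := [set v : 'rV[R]_n | forall k, v ord0 k \in `[-1, 1]].
have Q_compact : compact Q.
  by have := @rV_compact R n (fun=> `[-1, 1]%classic) (fun=> @segment_compact _ _ _).
have Q0 : Q !=set0 by exists 0 => k /=; rewrite mxE in_itv/=; lra.
have [x _ xmax] := compact_EVT_max Q0 Q_compact (continuous_subspaceT fc).
exists x => y; have [z] := near_lattice 0 y.
move=> /rV_norm_leP yz; rewrite -(fper z); apply: xmax; rewrite inE => k /=.
have := yz _ k; rewrite subr0 in_itv/= ler_norml => /(_ ltac:(lra)); lra.
Qed.

Lemma C_torusN f : C_torus f -> C_torus (fun x => - f x).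
Proof.
by move=> [fc fp]; split=> [x|z x]; [exact: (cvgN (fc x))|rewrite /= fp].
Qed.

Lemma C_torusB f h : C_torus f -> C_torus h -> C_torus (fun x => f x - h x).
Proof.
move=> [fc fp] [hc hp]; split=> [x|z x]; last by rewrite fp hp.
exact: (cvgB (fc x) (hc x)).
Qed.

Lemma C1_torus_C f : C1_torus f -> C_torus f.
Proof. by move=> [fp fd _]; split=> // x; apply: differentiable_continuous. Qed.

(** The filter [nbhs x] on row vectors is defined entrywise; the estimates below
use the sup norm. *)
Lemma nbhs_rVP x (P : set 'rV[R]_n) :
  nbhs x P <-> exists2 d : R, 0 < d & forall y, `|x - y| < d -> P y.
Proof.
split=> [/nbhs_ballP[d d0]|[d d0 dP]]; last apply/nbhs_ballP.
  by rewrite mx_norm_ball => dP; exists d.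
by exists d => //; rewrite mx_norm_ball.
Qed.

Lemma continuous_rVP f : continuous f <->
  forall x e, 0 < e -> exists2 d, 0 < d & forall y, `|x - y| < d -> `|f x - f y| <= e.
Proof.
split=> [fc x e e0|fc x]; first exact/nbhs_rVP/(@cvgr_dist_le _ _ _ (nbhs x) _ f _ (fc x)).
apply/(@cvgrPdist_le _ _ _ (nbhs x) (nbhs_filter x)) => e e0.
exact/nbhs_rVP/fc.
Qed.

Lemma lipschitz_continuous f (K : R) :
  (forall x y, f x - f y <= K * `|x - y|) -> continuous f.
Proof.
move=> fK; apply/continuous_rVP => x e e0.
pose K' := `|K| + 1.
have K'0 : 0 < K' by rewrite /K'; have := normr_ge0 K; lra.
exists (e / K') => [|y]; first exact: divr_gt0.
rewrite ltr_pdivlMr// mulrC => xy.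
have KK' : K * `|x - y| <= K' * `|x - y|.
  by rewrite ler_wpM2r// /K'; have := ler_norm K; lra.
rewrite ler_norml (le_trans (fK _ _) (le_trans KK' (ltW xy))) andbT.
by rewrite lerNl opprB (le_trans (fK _ _))// distrC (le_trans KK')// ltW.
Qed.

End Torus.

(** * Gradients of test functions *)

Section Gradient.
Context {R : realType} {n : nat}.
Implicit Types (x y v : 'rV[R]_n) (f h : 'rV[R]_n -> R) (z : 'rV[int]_n).

Lemma diff_gradient f x v : differentiable f x -> 'd f x v = dotp (gradient f x) v.
Proof.
move=> fd; rewrite {1}[v]row_sum_delta linear_sum; apply: eq_bigr => k _.
by rewrite linearZ/= mxE -deriveE// mulrC.
Qed.

Lemma gradientP f x (p : 'rV[R]_n) :
  (forall k, 'D_(delta_mx 0 k) f x = p 0 k) -> gradient f x = p.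
Proof. by move=> fp; apply/rowP => k; rewrite mxE. Qed.

Lemma gradientD f h x : differentiable f x -> differentiable h x ->
  gradient (fun y => f y + h y) x = gradient f x + gradient h x.
Proof.
move=> fd hd; apply: gradientP => k; rewrite !mxE.
by apply: (etrans (deriveD (diff_derivable fd) (diff_derivable hd))).
Qed.

Lemma gradientN f x : differentiable f x ->
  gradient (fun y => - f y) x = - gradient f x.
Proof.
move=> fd; apply: gradientP => k; rewrite !mxE.
by apply: (etrans (deriveN (diff_derivable fd))).
Qed.

Lemma gradient_cst (c : R) x : gradient (cst c) x = 0.
Proof. by apply: gradientP => k; rewrite mxE derive_cst. Qed.

Lemma gradient_periodic f : Zn_periodic f -> Zn_periodic (gradient f).
Proof.
move=> fp z x; apply/rowP => k; rewrite !mxE /derive fp.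
have -> // : f \o shift (x + map_mx intr z) = f \o shift x.
by apply/funext => y /=; rewrite addrA fp.
Qed.

Lemma C1_torusD f h : C1_torus f -> C1_torus h -> C1_torus (fun y => f y + h y).
Proof.
move=> [fp fd fc] [hp hd hc]; split=> [z y|y|]; first by rewrite fp hp.
  exact: (differentiableD (fd y) (hd y)).
have -> : gradient (fun y => f y + h y) = fun y => gradient f y + gradient h y.
  by apply/funext => y; exact: gradientD.
by move=> y; exact: (cvgD (fc y) (hc y)).
Qed.

Lemma C1_torusN f : C1_torus f -> C1_torus (fun y => - f y).
Proof.
move=> [fp fd fc]; split=> [z y|y|]; first by rewrite /= fp.
  exact: (differentiableN (fd y)).
have -> : gradient (fun y => - f y) = fun y => - gradient f y.
  by apply/funext => y; exact: gradientN.
by move=> y; exact: (cvgN (fc y)).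
Qed.

Lemma C1_torus_cst (c : R) : C1_torus (cst c : 'rV[R]_n -> R).
Proof.
split=> [//|x|]; first exact: differentiable_cst.
have -> : gradient (cst c : 'rV[R]_n -> R) = cst 0.
  by apply/funext => x; exact: gradient_cst.
by move=> x; exact: cst_continuous.
Qed.

Lemma is_derive_line f x v (t : R) : (forall y, differentiable f y) ->
  is_derive t 1 (fun s => f (x + s *: v)) (dotp (gradient f (x + t *: v)) v).
Proof.
move=> fd; rewrite -diff_gradient//.
have ld : is_diff t (fun s : R => x + s *: v) (fun s => s *: v).
  by apply: is_diff_eq; apply/funext => s; rewrite /= !fctE add0r.
have cd : differentiable (f \o (fun s : R => x + s *: v)) t.
  by apply: differentiable_comp => //; exact: ex_diff.
apply: DeriveDef; first exact/derivable1_diffP.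
rewrite -[LHS]/('D_1 (f \o (fun s : R => x + s *: v)) t) deriveE// diff_comp//=.
by rewrite (@diff_val _ _ _ _ _ _ _ ld) scale1r.
Qed.

(** The restriction of [f] to the line through [x] in a coordinate direction
has a maximum at [x]. *)
Lemma gradient_at_max f x : (forall y, differentiable f y) ->
  (exists2 d : R, 0 < d & forall y, `|x - y| < d -> f y <= f x) -> gradient f x = 0.
Proof.
move=> fd [d d0 xmax]; apply: gradientP => k; rewrite mxE.
set v := delta_mx 0 k; have fl t := is_derive_line x v t fd.
have v1 : `|v| <= 1.
  by apply/rV_norm_leP => // j; rewrite mxE normr_nat; case: (_ && _).
have D0 : is_derive (0 : R) (1 : R) (fun s : R => f (x + s *: v)) (0 : R).
  apply: (@derive1_at_max _ _ (- d) d) => [|t _| |t]; first by lra.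
  - by have [] := fl t.
  - by rewrite in_itv/=; lra.
  rewrite in_itv/= scale0r addr0 -ltr_norml => td; apply: xmax.
  rewrite opprD addNKr normrN normrZ (le_lt_trans _ td)//.
  by rewrite ler_piMr.
have [_] := fl 0; have [_ ->] := D0; rewrite scale0r addr0.
by rewrite -diff_gradient// -deriveE// => <-.
Qed.

Lemma gradient_touching f h x : (forall y, differentiable f y) ->
  (forall y, differentiable h y) ->
  (exists2 d : R, 0 < d & forall y, `|x - y| < d -> f y - h y <= f x - h x) ->
  gradient f x = gradient h x.
Proof.
move=> fd hd xmax; apply/eqP; rewrite -subr_eq0 -gradientN// -gradientD//; last first.
  exact: differentiableN.
apply/eqP/gradient_at_max => // y.
by apply: differentiableD => //; exact: differentiableN.
Qed.

(** The segment from [y] to [x] stays in the ball, which is convex, so the mean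
value theorem along it involves only gradients bounded by [K]. *)
Lemma mean_value_le f x0 (r K : R) x y : (forall y, differentiable f y) ->
  (forall y, `|y - x0| < r -> norm1 (gradient f y) <= K) ->
  `|x - x0| < r -> `|y - x0| < r -> f x - f y <= K * `|x - y|.
Proof.
move=> fd fK xr yr; pose g s := f (y + s *: (x - y)).
have gd s := is_derive_line y (x - y) s fd.
have gc : {within `[0, 1], continuous g}.
  apply: continuous_subspaceT => s; apply: differentiable_continuous.
  exact/derivable1_diffP/ex_derive.
have [s] := MVT_segment ler01 (fun s _ => gd s) gc.
rewrite in_itv/= => /andP[s0 s1]; rewrite /g scale0r addr0 scale1r subrKC => ->.
rewrite subr0 mulr1 (le_trans (dotp_le _ _))// ler_wpM2r//; apply: fK.
have -> : y + s *: (x - y) - x0 = s *: (x - x0) + (1 - s) *: (y - x0).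
  by apply/rowP => k; rewrite !mxE; ring.
rewrite (le_lt_trans (ler_normD _ _))// !normrZ !ger0_norm ?subr_ge0//.
have := le_lt_trans (normr_ge0 _) xr => r0; move: s0; rewrite le_eqVlt.
by move=> /orP[/eqP<-|s0]; [rewrite mul0r add0r subr0 mul1r|nra].
Qed.

End Gradient.

(** * A periodic penalization vanishing on one lattice orbit *)

Section Ripple.
Context {R : realType} {n : nat}.
Implicit Types (x y v : 'rV[R]_n).

Definition wave (t : R) : R := 1 - cos (2 * pi * t).

Lemma wave_ge0 t : 0 <= wave t.
Proof. by rewrite subr_ge0 cos_le1. Qed.

Lemma waveDz t (z : int) : wave (t + z%:~R) = wave t.
Proof.
have waveDn s (k : nat) : wave (s + k%:R) = wave s.
  rewrite /wave mulrDr; congr (1 - _).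
  rewrite -[RHS](periodicn (@cosD2pi R) k) -[(pi *+ 2) *+ k]mulr_natr.
  by rewrite -[pi *+ 2]mulr_natl.
case: z => k; first exact: waveDn.
by rewrite NegzE -(waveDn _ k.+1) mulrNz subrK.
Qed.

(** The cosine decreases on [[0, pi]], so on half a period [wave] is increasing
in the distance to the integers. *)
Lemma wave_lt t (r : R) : 0 < r -> `|t| <= 2^-1 -> wave t < wave r -> `|t| < r.
Proof.
move=> r0 t2 tr; have pi0 := @pi_gt0 R.
have [r2|r2] := leP r 2^-1; last exact: le_lt_trans r2.
have := tr; rewrite /wave ltrD2l ltrN2 -(cos_norm (2 * pi * t)).
have tE : `|2 * pi * t| = 2 * pi * `|t| by rewrite normrM ger0_norm//; lra.
have := normr_ge0 t => t0.
by rewrite tE ltr_cos ?in_itv/=; nra.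
Qed.

Lemma is_derive_wave (t : R) :
  is_derive t (1 : R) wave (2 * pi * sin (2 * pi * t) : R).
Proof.
have d1 : is_derive t (1 : R) (fun s : R => 2 * pi * s) (2 * pi : R).
  by apply: is_derive_eq; rewrite /GRing.scale/= mulr1.
have d2 : is_derive t (1 : R) (fun s => cos (2 * pi * s))
    (- sin (2 * pi * t) * (2 * pi) : R).
  exact: (@is_derive1_comp _ cos _ _ _ _ (is_derive_cos _) d1).
by rewrite /wave; apply: is_derive_eq; rewrite ?add0r; ring.
Qed.

(** A smooth periodic substitute for the squared distance to [x0], which is not
periodic: it vanishes together with its gradient on [x0 + Z^n] and is positive
elsewhere. Adding it to a test function makes a maximum at [x0] strict modulo
the lattice and leaves the gradient at [x0] unchanged. *)
Definition ripple x0 y : R := \sum_k wave (y 0 k - x0 0 k).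

Lemma ripple_ge0 x0 y : 0 <= ripple x0 y.
Proof. by apply: sumr_ge0 => k _; exact: wave_ge0. Qed.

Lemma ripple_center x0 : ripple x0 x0 = 0.
Proof. by rewrite /ripple big1// => k _; rewrite subrr /wave mulr0 cos0 subrr. Qed.

Lemma ripple_periodic x0 : Zn_periodic (ripple x0).
Proof.
by move=> z y; apply: eq_bigr => k _; rewrite !mxE addrAC waveDz.
Qed.

Lemma ripple_near (r : R) : 0 < r <= 2^-1 -> exists2 e : R, 0 < e &
  forall x0 y, `|y - x0| <= 2^-1 -> ripple x0 y < e -> `|y - x0| < r.
Proof.
move=> /andP[r0 r2]; have pi0 := @pi_gt0 R; exists (wave r) => [|x0 y yx yr].
  rewrite /wave subr_gt0 -[ltRHS]cos0 ltr_cos ?in_itv/=; nra.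
have /rV_norm_leP/= {}yx := yx; apply/rV_norm_ltP => // k.
have := yx ltac:(lra) k; rewrite !mxE => yxk; apply: wave_lt => //.
rewrite (le_lt_trans _ yr)// /ripple (bigD1 k)//= lerDl sumr_ge0// => j _.
exact: wave_ge0.
Qed.

Lemma is_diff_coord k y :
  is_diff y (fun x : 'rV[R]_n => x 0 k : R) (fun v => v 0 k).
Proof.
have @f : {linear 'rV[R]_n -> R}.
  by exists (fun x : 'rV[R]_n => x 0 k); do 2![eexists]; do ?[constructor];
     rewrite ?mxE// => ? *; rewrite ?mxE//; move=> ?; rewrite !mxE.
have -> : (fun x : 'rV[R]_n => x 0 k) = f by [].
by apply: DiffDef; [exact/linear_differentiable/coord_continuous|
  rewrite diff_lin//; exact: coord_continuous].
Qed.

Lemma is_diff_wave t : is_diff t wave (fun h => h * (2 * pi * sin (2 * pi * t))).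
Proof.
have [wd wt] := is_derive_wave t; have wD : differentiable wave t.
  exact/derivable1_diffP.
apply: DiffDef => //; rewrite diff1E// derive1E wt.
by apply/funext => h.
Qed.

Lemma is_diff_ripple_term x0 y k : is_diff y (fun x => wave (x 0 k - x0 0 k))
  (fun v => v 0 k * (2 * pi * sin (2 * pi * (y 0 k - x0 0 k)))).
Proof.
have d1 : is_diff y (fun x : 'rV[R]_n => x 0 k - x0 0 k) (fun v => v 0 k).
  have dc := is_diff_coord k y.
  by apply: is_diff_eq; apply/funext => v; rewrite /= !fctE subr0.
exact: (is_diff_comp d1 (is_diff_wave _)).
Qed.

Lemma rippleE x0 : ripple x0 = \sum_k (fun x => wave (x 0 k - x0 0 k)).
Proof. by apply/funext => y; rewrite /ripple fct_sumE. Qed.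

Lemma differentiable_ripple x0 y : differentiable (ripple x0) y.
Proof.
rewrite rippleE; apply: differentiable_sum => k.
by have := is_diff_ripple_term x0 y k => d; exact: ex_diff.
Qed.

Lemma gradient_ripple x0 y :
  gradient (ripple x0) y = \row_k (2 * pi * sin (2 * pi * (y 0 k - x0 0 k))).
Proof.
apply/rowP => k; rewrite !mxE rippleE derive_sum => [|j]; last first.
  by apply: diff_derivable; have := is_diff_ripple_term x0 y j => d; exact: ex_diff.
rewrite (bigD1 k)//= big1 ?addr0 => [|j jk].
  have d := is_diff_ripple_term x0 y k; rewrite deriveE ?diff_val; last exact: ex_diff.
  by rewrite mxE !eqxx mul1r.
have d := is_diff_ripple_term x0 y j; rewrite deriveE ?diff_val; last exact: ex_diff.
by rewrite mxE (negbTE jk) andbF mul0r.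
Qed.

Lemma gradient_ripple_center x0 : gradient (ripple x0) x0 = 0.
Proof.
by apply/rowP => k; rewrite gradient_ripple !mxE subrr mulr0 sin0 mulr0.
Qed.

Lemma continuous_rV (T : topologicalType) (f : T -> 'rV[R]_n) :
  (forall k, continuous (fun t => f t 0 k)) -> continuous f.
Proof.
move=> fc x A [P Px PA].
have : \forall y \near x, forall i j, P i j (f y i j).
  apply: filter_forall => i; apply: filter_forall => j.
  by rewrite (ord1 i); apply: (fc j x); rewrite -(ord1 i); exact: Px.
by apply: filterS => y fy; apply: PA.
Qed.

Lemma C1_torus_ripple x0 : C1_torus (ripple x0).
Proof.
split; [exact: ripple_periodic|exact: differentiable_ripple|].
apply: continuous_rV => k y.
have -> : (fun x => gradient (ripple x0) x 0 k) =
    (fun t => 2 * pi * sin (2 * pi * (t - x0 0 k))) \o (fun x : 'rV[R]_n => x 0 k).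
  by apply/funext => x; rewrite gradient_ripple mxE.
apply: continuous_comp; first exact: coord_continuous.
apply: cvgM; first exact: cvg_cst.
apply: (continuous_comp (f := fun t => 2 * pi * (t - x0 0 k)) (g := sin));
  last exact: continuous_sin.
apply: cvgM; first exact: cvg_cst.
by apply: cvgB; [exact: cvg_id|exact: cvg_cst].
Qed.

End Ripple.

(** * Stability of viscosity inequalities *)

(** Since [f - psi] is maximal at [x0], the function [f - psi - ripple x0] has a
maximum there that is strict modulo the lattice, so the maxima of nearby
[h - psi - ripple x0] lie close to [x0] up to a translation. Closeness is asked
for from above everywhere but from below only at [x0]: this is what a supremum
of subsolutions provides. *)
Lemma perturbed_max (R : realType) (n : nat) (f psi : 'rV[R]_n -> R) x0 (r : R) :
  C1_torus psi -> (forall y, f y - psi y <= f x0 - psi x0) -> 0 < r ->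
  exists2 e0 : R, 0 < e0 & forall e h, e <= e0 -> C_torus h ->
    f x0 - e <= h x0 -> (forall y, h y <= f y + e) ->
  exists y, [/\ `|x0 - y| < r, f y - 2 * e <= h y &
    forall y', h y' - (psi y' + ripple x0 y') <= h y - (psi y + ripple x0 y)].
Proof.
move=> psiC fmax r0; have [psip _ _] := psiC; pose r' := Num.min r 2^-1.
have [b b0 near] : exists2 b : R, 0 < b & forall (x0 y : 'rV[R]_n),
    `|y - x0| <= 2^-1 -> ripple x0 y < b -> `|y - x0| < r'.
  by apply: ripple_near; rewrite lt_min r0 ge_min lexx orbT andbT; lra.
exists (b / 3) => [|e h eb hC hx0 hf]; first by lra.
have gC := C1_torus_C (C1_torusD psiC (C1_torus_ripple x0)).
have [y ymax] := C_torus_max (C_torusB hC gC).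
have [z yz] := near_lattice x0 y.
have ymax' y' : h y' - (psi y' + ripple x0 y') <=
    h (y + map_mx intr z) - (psi (y + map_mx intr z) + ripple x0 (y + map_mx intr z)).
  by rewrite hC.2 psip ripple_periodic.
exists (y + map_mx intr z); move: (y + _) yz ymax' => {ymax}y yz ymax.
(* Comparing the values at [x0] and [y] bounds [ripple x0 y] by [2 * e]. *)
have h1 := ymax x0; rewrite ripple_center in h1.
have h2 := fmax y; have h3 := hf y; have h4 := ripple_ge0 x0 y.
split=> //; last by lra.
have := near x0 y yz ltac:(lra); rewrite /r' lt_min => /andP[].
by rewrite distrC.
Qed.

Lemma continuous_along_gradient (R : realType) (n : nat)
    (H0 : 'rV[R]_n -> 'rV[R]_n -> R) (psi : 'rV[R]_n -> R) :
  continuous (fun z : 'rV[R]_n * 'rV[R]_n => H0 z.1 z.2) -> C1_torus psi ->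
  continuous (fun x => H0 x (gradient psi x)).
Proof.
move=> H0c [_ _ gc] x.
apply: (@continuous_comp _ _ _ (fun y => (y, gradient psi y)) (fun z => H0 z.1 z.2)).
  exact: (cvg_pair cvg_id (gc x)).
exact: H0c.
Qed.

(** The one limiting argument behind both Perron's method and the vanishing
discount. Here [H0] is any continuous scalar Hamiltonian and [G] stands for the
terms of the equation without gradient. If [f] can be approximated by functions
[h] that satisfy the inequality with [F] in place of [G], then test [h] with
[psi + ripple x0]: by [perturbed_max] the maximum is attained near [x0], and
continuity transports the inequality back to [x0]. *)
Lemma viscosity_stability (R : realType) (n : nat)
    (H0 : 'rV[R]_n -> 'rV[R]_n -> R) (f G psi : 'rV[R]_n -> R) x0 (M : R) :
  continuous (fun z : 'rV[R]_n * 'rV[R]_n => H0 z.1 z.2) -> continuous G ->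
  C1_torus psi -> (forall y, f y - psi y <= f x0 - psi x0) ->
  (forall e, 0 < e -> exists h F, [/\ C_torus h, f x0 - e <= h x0,
    forall y, h y <= f y + e,
    forall y, f y - 2 * e <= h y -> G y <= F y + M * e &
    forall phi y, C1_torus phi -> (forall y', h y' - phi y' <= h y - phi y) ->
      F y + H0 y (gradient phi y) <= 0]) ->
  G x0 + H0 x0 (gradient psi x0) <= 0.
Proof.
move=> H0c Gc psiC fmax approx; rewrite leNgt; apply/negP; set eta := G x0 + _ => eta0.
pose phi y := psi y + ripple x0 y.
have phiC : C1_torus phi := C1_torusD psiC (C1_torus_ripple x0).
have [_ psid _] := psiC.
have Tc : continuous (fun y => G y + H0 y (gradient phi y)).
  move=> y; have Hc := continuous_along_gradient H0c phiC.
  exact: (@cvgD _ _ _ (nbhs y) (nbhs_filter y) G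
    (fun y => H0 y (gradient phi y)) _ _ (Gc y) (Hc y)).
have Tx0 : G x0 + H0 x0 (gradient phi x0) = eta.
  by rewrite /phi gradientD ?gradient_ripple_center ?addr0//; exact: differentiable_ripple.
have [r r0 Tr] := (continuous_rVP _).1 Tc x0 (eta / 2) ltac:(lra).
have [e0 e00 near] := perturbed_max psiC fmax r0.
pose e := Num.min e0 (eta / 2 / (`|M| + 1) / 2).
have M1 : 0 < `|M| + 1 by rewrite ltr_wpDl.
have e_gt0 : 0 < e by rewrite lt_min e00/= !divr_gt0.
have [h [F [hC hx0 hf GF sub]]] := approx e e_gt0.
have [y [yx0 hy ymax]] := near e h ltac:(by rewrite ge_min lexx) hC hx0 hf.
have := Tr y yx0; rewrite Tx0 ler_norml => /andP[_].
have := sub phi y phiC ymax; have := GF y hy.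
have : M * e < eta / 2.
  apply: (@le_lt_trans _ _ ((`|M| + 1) * e)).
    by rewrite ler_wpM2r ?(ltW e_gt0)//; have := ler_norm M; lra.
  rewrite mulrC -ltr_pdivlMr// (@le_lt_trans _ _ (eta / 2 / (`|M| + 1) / 2))//.
    by rewrite ge_min lexx orbT.
  have : 0 < eta / 2 / (`|M| + 1) by rewrite !divr_gt0.
  lra.
lra.
Qed.

(** * Monotone matrices and their resolvents *)

(** An ultrafilter that has a cluster point converges to it. Working along a
fixed ultrafilter makes all the bounded quantities converge at once, without
extraction of subsequences. *)
Lemma ultra_bounded_cvg (R : realType) (T : Type) (F : set_system T) (f : T -> R)
    (a b : R) : UltraFilter F -> F [set t | a <= f t <= b] -> cvg (f @ F).
Proof.
move=> FU Fab; have FF : ProperFilter F := @ultra_proper _ F FU.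
have Fab' : F (f @^-1` `[a, b]%classic).
  by apply: filterS Fab => t /=; rewrite in_itv.
have [l [_ lcl]] := @segment_compact R a b (f @ F) (fmap_proper_filter f FF) Fab'.
apply/cvg_ex; exists l => N Nl.
have [//|FN] := in_ultra_setVsetC (f @^-1` N) FU.
by have [y [nNy Ny]] := lcl (~` N) N FN Nl; case: nNy.
Qed.

Section MMatrices.
Context {R : realType} {m : nat}.
Implicit Types (A B P : 'M[R]_m) (x u w : 'cV[R]_m) (lam : R).

Lemma mulmx_colE A x i : (A *m x) i 0 = \sum_j A i j * x j 0.
Proof. by rewrite mxE. Qed.

Lemma cV_max x k0 : exists k : 'I_m, x k0 0 <= x k 0 /\ forall i, x i 0 <= x k 0.
Proof.
by have [k _ kmax] := @Order.TotalTheory.arg_maxP _ _ _ k0 xpredT (fun i => x i 0) isT;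
  exists k; split=> [|i]; exact: kmax.
Qed.

Lemma monotone_offdiag_le0 B : monotone_mx B -> forall i j, i != j -> B i j <= 0.
Proof.
move=> Bm i j ij; have := Bm (- delta_mx j 0) i.
rewrite mulmxN -colE !mxE (negbTE ij) oppr0 oppr_ge0; apply=> // k.
by rewrite !mxE oppr_le0; case: (_ && _).
Qed.

Lemma monotone_diag_ge0 B : monotone_mx B -> forall i, 0 <= B i i.
Proof.
move=> Bm i; have := Bm (delta_mx i 0) i.
rewrite -colE !mxE !eqxx; apply=> // k.
by rewrite !mxE; case: (_ && _).
Qed.

Lemma monotone_rowsum_ge0 B : monotone_mx B ->
  forall i, 0 <= (B *m (const_mx 1 : 'cV[R]_m)) i 0.
Proof. by move=> Bm i; apply: Bm => [j|]; rewrite !mxE. Qed.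

Lemma mulmx_discount B lam x i : ((lam%:M + B) *m x) i 0 = lam * x i 0 + (B *m x) i 0.
Proof. by rewrite mulmxDl mul_scalar_mx !mxE. Qed.

(** At the largest entry of [x], if positive, monotonicity gives
[0 <= (B *m x) k 0] and the discount makes the inequality strict. *)
Lemma discount_max_principle B lam x : monotone_mx B -> 0 < lam ->
  (forall k, 0 < x k 0 -> ((lam%:M + B) *m x) k 0 <= 0) -> forall i, x i 0 <= 0.
Proof.
move=> Bm lam0 xsub i; have [k [ik kmax]] := cV_max x i.
rewrite (le_trans ik)// leNgt; apply/negP => xk.
have := xsub k xk; rewrite mulmx_discount; have := Bm x k kmax (ltW xk); nra.
Qed.

Lemma discount_unit B lam : monotone_mx B -> 0 < lam -> lam%:M + B \in unitmx.
Proof.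
move=> Bm lam0; rewrite -unitmx_tr unitmxE unitfE; apply/det0P => -[v v0 vA].
have Av : (lam%:M + B) *m v^T = 0.
  by apply: trmx_inj; rewrite trmx_mul trmxK trmx0.
have vle0 := @discount_max_principle B lam v^T Bm lam0.
have vge0 := @discount_max_principle B lam (- v^T) Bm lam0.
move/negP: v0; apply; apply/eqP/rowP => i; rewrite mxE; apply/eqP.
have := vle0 _ i; have := vge0 _ i; rewrite mulmxN Av !mxE eq_le oppr_le0 => h1 h2.
by rewrite h1 ?h2// => k _; rewrite !mxE ?oppr0.
Qed.

(** For [lam > 0], the Abel mean of the semigroup generated by [- B]: when [B] is
monotone, a substochastic matrix. *)
Definition resolvent B lam : 'M[R]_m := lam *: invmx (lam%:M + B).

Section Resolvent.
Variables (B : 'M[R]_m) (lam : R).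
Hypotheses (Bm : monotone_mx B) (lam0 : 0 < lam).

Lemma resolvent_mulmx : resolvent B lam *m B = lam%:M - lam *: resolvent B lam.
Proof.
have Au := discount_unit Bm lam0.
have <- : resolvent B lam *m (lam%:M + B) = lam%:M.
  by rewrite -scalemxAl mulVmx// scalemx1.
by rewrite mulmxDr mul_mx_scalar addrAC subrr add0r.
Qed.

Lemma mulmx_resolvent : B *m resolvent B lam = lam%:M - lam *: resolvent B lam.
Proof.
have Au := discount_unit Bm lam0.
have <- : (lam%:M + B) *m resolvent B lam = lam%:M.
  by rewrite -scalemxAr mulmxV// scalemx1.
by rewrite mulmxDl mul_scalar_mx addrAC subrr add0r.
Qed.

Lemma discount_resolvent x : (lam%:M + B) *m (resolvent B lam *m x) = lam *: x.
Proof.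
have Au := discount_unit Bm lam0.
by rewrite mulmxA -scalemxAr mulmxV// scalemx1 mul_scalar_mx.
Qed.

Lemma resolvent_ge0 i j : 0 <= resolvent B lam i j.
Proof.
have xge0 := @discount_max_principle B lam (- (resolvent B lam *m delta_mx j 0)) Bm lam0.
have := xge0 _ i; rewrite -colE !mxE oppr_le0; apply=> k _.
rewrite mulmxN colE discount_resolvent !mxE oppr_le0 mulr_ge0 ?(ltW lam0)//.
Qed.

Lemma resolvent_row_le1 i : (resolvent B lam *m (const_mx 1 : 'cV[R]_m)) i 0 <= 1.
Proof.
have := @discount_max_principle B lam
  (resolvent B lam *m const_mx 1 - const_mx 1 : 'cV[R]_m) Bm lam0 _ i.
rewrite !mxE subr_le0; apply=> k _.
rewrite mulmxBr discount_resolvent !mxE -[X in _ - X]mulmx_colE mulmx_discount !mxE.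
have := monotone_rowsum_ge0 Bm k; rewrite mulmx_colE; lra.
Qed.

Lemma resolvent_le1 i j : resolvent B lam i j <= 1.
Proof.
rewrite (le_trans _ (resolvent_row_le1 i))// mulmx_colE (bigD1 j)//=.
rewrite [const_mx _ _ _]mxE mulr1 lerDl.
by rewrite sumr_ge0// => k _; rewrite [const_mx _ _ _]mxE mulr1 resolvent_ge0.
Qed.

Lemma resolvent_fix x : B *m x = 0 -> resolvent B lam *m x = x.
Proof.
move=> Bx; have Au := discount_unit Bm lam0.
have : (lam%:M + B) *m x = lam *: x by rewrite mulmxDl Bx addr0 mul_scalar_mx.
move=> /(congr1 (mulmx (invmx (lam%:M + B)))); rewrite mulKmx// => {2}->.
by rewrite -scalemxAr -scalemxAl.
Qed.

End Resolvent.

(** The limit [P] of the resolvents as [lam] tends to [0] along an ultrafilter.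
Its rows are nonnegative left null vectors of [B]; this replaces the
Perron-Frobenius theorem and the decomposition of [B] into irreducible blocks. *)
Lemma ergodic_projector B : monotone_mx B -> exists P : 'M[R]_m,
  [/\ forall i j, 0 <= P i j, P *m B = 0, B *m P = 0 & forall x, B *m x = 0 -> P *m x = x].
Proof.
move=> Bm; have [F [FU F0]] := ultraFilterLemma (@at_right_proper_filter R 0).
have FF : ProperFilter F := @ultra_proper _ F FU.
have Fpos : F [set lam | 0 < lam] by apply: F0; exact: nbhs_right_gt.
have Fid : (fun lam : R => lam) @ F --> (0 : R).
  apply: (@cvg_trans _ (nbhs (0 : R)^'+)); first exact: F0.
  exact: cvg_at_right_filter.
pose P : 'M[R]_m := \matrix_(i, j) lim ((fun lam => resolvent B lam i j) @ F).
have cvgP i j : (fun lam => resolvent B lam i j) @ F --> P i j.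
  rewrite mxE; apply: (@ultra_bounded_cvg _ _ _ _ 0 1) => //.
  by apply: filterS Fpos => lam lam0 /=; rewrite resolvent_ge0// resolvent_le1.
have lim_eq (f g : R -> R) (a b : R) : f @ F --> a -> g @ F --> b ->
    (forall lam, 0 < lam -> f lam = g lam) -> a = b.
  move=> fa gb fg; apply: (cvg_unique (@norm_hausdorff R R) fa).
  by apply: cvg_trans gb; apply: near_eq_cvg; apply: filterS Fpos => lam /fg.
have rhs0 i j : (fun lam => (lam%:M - lam *: resolvent B lam) i j) @ F --> (0 : R).
  have -> : (fun lam => (lam%:M - lam *: resolvent B lam) i j) =
      (fun lam => lam * ((i == j)%:R - resolvent B lam i j)).
    by apply/funext => lam; rewrite !mxE mulrBr mulr_natr.
  rewrite -[0](mul0r ((i == j)%:R - P i j)); apply: cvgM => //.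
  by apply: cvgB => //; exact: cvg_cst.
exists P; split.
- move=> i j; apply: (cvgr_to_ge (cvgP i j)); apply: filterS Fpos => lam lam0.
  exact: resolvent_ge0.
- apply/matrixP => i j; rewrite [in RHS]mxE.
  apply: (lim_eq (fun lam => (resolvent B lam *m B) i j) _ _ _ _ (rhs0 i j)).
    under eq_fun do rewrite mxE; rewrite mxE; apply: cvg_sumr => k.
    by apply: cvgM => //; exact: cvg_cst.
  by move=> lam lam0; rewrite resolvent_mulmx.
- apply/matrixP => i j; rewrite [in RHS]mxE.
  apply: (lim_eq (fun lam => (B *m resolvent B lam) i j) _ _ _ _ (rhs0 i j)).
    under eq_fun do rewrite mxE; rewrite mxE; apply: cvg_sumr => k.
    by apply: cvgM => //; exact: cvg_cst.
  by move=> lam lam0; rewrite mulmx_resolvent.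
- move=> x Bx; apply/colP => i.
  apply: (lim_eq (fun lam => (resolvent B lam *m x) i 0) (cst (x i 0)) _ _ _ _).
  + under eq_fun do rewrite mxE; rewrite mxE; apply: cvg_sumr => k.
    by apply: cvgM => //; exact: cvg_cst.
  + exact: cvg_cst.
  + by move=> lam lam0; rewrite resolvent_fix.
Qed.

(** Call [j] recurrent if it is charged by a nonnegative left null vector of [B].
The recurrent indices include the nonzero columns of the projector [P] of
[ergodic_projector]. If [T] is the indicator of the zero columns, then
[P *m T = 0]; as [B + P] is invertible ([P] is idempotent and restricts to the
identity on the kernel of [B]), the solution [y] of [(B + P) *m y = T] satisfies
[P *m y = 0], hence [B *m y = T]. Adding a constant makes [y] nonnegative and
does not decrease [B *m y], as the row sums of [B] are nonnegative. The
resulting barrier [z] is independent of the discount. *)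
Lemma null_vector_or_barrier B : monotone_mx B -> exists z : 'cV[R]_m,
  [/\ forall i, 0 <= z i 0, forall i, 0 <= (B *m z) i 0 & forall j,
    (exists q : 'rV[R]_m, [/\ forall i, 0 <= q 0 i, q *m B = 0 & 0 < q 0 j]) \/
    1 <= (B *m z) j 0].
Proof.
move=> Bm; have [P [P0 PB BP Pfix]] := ergodic_projector Bm.
have PP : P *m P = P.
  apply/matrixP => i j; have := Pfix (P *m delta_mx j 0).
  rewrite mulmxA BP mul0mx mulmxA -!colE => /(_ erefl)/colP/(_ i).
  by rewrite !mxE.
pose T : 'cV[R]_m := \col_j [forall i, P i j == 0]%:R.
have PT : P *m T = 0.
  apply/colP => i; rewrite !mxE big1// => j _; rewrite !mxE.
  by case: forallP => [/(_ i)/eqP->|]; rewrite ?mul0r ?mulr0.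
have BPu : B + P \in unitmx.
  rewrite -unitmx_tr unitmxE unitfE; apply/det0P => -[v v0 vA].
  have Av : (B + P) *m v^T = 0 by apply: trmx_inj; rewrite trmx_mul trmxK trmx0.
  have Pv : P *m v^T = 0.
    have : P *m ((B + P) *m v^T) = 0 by rewrite Av mulmx0.
    by rewrite mulmxA mulmxDr PB PP add0r.
  have Bv : B *m v^T = 0 by move: Av; rewrite mulmxDl Pv addr0.
  move/negP: v0; apply; apply/eqP/trmx_inj; rewrite trmx0 -Pv.
  by rewrite Pfix.
pose y := invmx (B + P) *m T.
have By : B *m y = T.
  have ABy : (B + P) *m y = T by rewrite mulKVmx.
  have Py : P *m y = 0.
    have : P *m ((B + P) *m y) = 0 by rewrite ABy.
    by rewrite mulmxA mulmxDr PB PP add0r.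
  by move: ABy; rewrite mulmxDl Py addr0.
pose s := \sum_i `|y i 0|.
have Bz i : (B *m (y + s *: const_mx 1)) i 0 >= T i 0.
  rewrite mulmxDr By -scalemxAr [leRHS]mxE [X in _ + X]mxE lerDl mulr_ge0 ?sumr_ge0//.
  exact: monotone_rowsum_ge0.
have T0 i : 0 <= T i 0 by rewrite mxE.
exists (y + s *: const_mx 1); split=> [i|i|j].
- rewrite [leRHS]mxE [X in _ + X]mxE [const_mx _ _ _]mxE mulr1 -lerBlDl sub0r.
  rewrite (le_trans (ler_norm _))// normrN /s (bigD1 i)//= lerDl.
  by rewrite sumr_ge0.
- exact: le_trans (Bz i).
case: (pickP (fun i => P i j != 0)) => [i Pij|P0j]; [left|right]; last first.
  apply: le_trans (Bz j); rewrite mxE (_ : [forall i, _]) //.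
  by apply/forallP => i; have := P0j i => /negbFE.
exists (row i P); split=> [k||].
- by rewrite mxE.
- by rewrite rowE -mulmxA PB mulmx0.
- by rewrite mxE lt_def Pij P0.
Qed.

End MMatrices.

(** * Perron's method among Lipschitz subsolutions *)

(** The function [q] is only known to be [k]-Lipschitz in the ball of radius [r]
about [x0], but it exceeds [w - e] only within [r / 4] of [x0 + Z^n]. For a point
[x] of that set and [y] outside the ball, the segment from [x] to [y] is cut at a
point [p] where [w] dominates, and both pieces are [k]-Lipschitz. *)
Lemma lipschitz_max_bump (R : realType) (n : nat) (w q : 'rV[R]_n -> R) x0 (k r e : R) :
  0 < r <= 2^-1 -> 0 < e -> Zn_periodic w -> Zn_periodic q ->
  (forall x y, w x - w y <= k * `|x - y|) ->
  (forall y, differentiable q y) ->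
  (forall y, `|y - x0| < r -> norm1 (gradient q y) <= k) ->
  (forall y, `|y - x0| <= 2^-1 -> w y < q y + e -> `|y - x0| < r / 4) ->
  forall x y, Num.max (w x) (q x + e) - Num.max (w y) (q y + e) <= k * `|x - y|.
Proof.
move=> /andP[r0 r2] e0 wp qp wk qd qk near x y.
have maxl a b : a <= Num.max a b :> R by rewrite le_max lexx.
have maxr a b : b <= Num.max a b :> R by rewrite le_max lexx orbT.
have [qw|wq] := leP (q x + e) (w x).
  have := maxl (w y) (q y + e); have := wk x y; lra.
have [z xz] := near_lattice x0 x.
have -> : `|x - y| = `|(x + map_mx intr z) - (y + map_mx intr z)|.
  by congr (`|_|); apply/rowP => j; rewrite !mxE; ring.
have wqz : w (x + map_mx intr z) < q (x + map_mx intr z) + e by rewrite wp qp.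
rewrite -(qp z x) -(wp z y) -(qp z y).
move: (x + _) (y + _) xz wqz => {wq}{}x {}y xx0 wq.
have {xx0}xr := near _ xx0 wq.
have [yr|yr] := ltP `|y - x0| r.
  have := @mean_value_le _ _ q x0 r k x y qd qk ltac:(lra) yr.
  have := maxr (w y) (q y + e); lra.
pose d := `|y - x|.
have dr : r - r / 4 < d.
  have := ler_normD (y - x) (x - x0); rewrite subrKA -/d; lra.
pose t := r / 2 / d; pose p := x + t *: (y - x).
have d0 : 0 < d by lra.
have td : t * d = r / 2 by rewrite /t divfK// gt_eqF.
have t0 : 0 < t by rewrite !divr_gt0.
have t1 : t <= 1 by rewrite ler_pdivrMr// mul1r; lra.
have px : `|x - p| = r / 2.
  by rewrite /p opprD addNKr normrN normrZ (gtr0_norm t0).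
have py : `|p - y| = d - r / 2.
  have -> : p - y = (1 - t) *: (x - y) by apply/rowP => j; rewrite !mxE; ring.
  by rewrite normrZ ger0_norm ?subr_ge0// distrC -/d mulrBl mul1r td.
have px0 : `|p - x0| < r.
  have := ler_normD (p - x) (x - x0); rewrite subrKA (distrC p x) px; lra.
have px0' : r / 4 <= `|p - x0|.
  have := ler_normD (x - x0) (x0 - p); rewrite subrKA px (distrC x0); lra.
(* [p] is at distance between [r / 4] and [r] from [x0], within the unit cube. *)
have qwp : q p + e <= w p.
  by rewrite leNgt; apply/negP => /(near p ltac:(lra)); lra.
have := @mean_value_le _ _ q x0 r k x p qd qk ltac:(lra) px0; rewrite px.
have := wk p y; rewrite py (distrC x) -/d.
have := maxl (w y) (q y + e); lra.
Qed.

Section Perron.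
Context {R : realType} {m n : nat}.
Implicit Types (x y : 'rV[R]_n) (u v : 'I_m -> 'rV[R]_n -> R) (i j : 'I_m).
Variables (H : 'I_m -> 'rV[R]_n -> 'rV[R]_n -> R) (A : 'M[R]_m).
Variables (K : 'I_m -> R) (lo C : R).
Hypothesis H_cont : forall i, continuous (fun z : 'rV[R]_n * 'rV[R]_n => H i z.1 z.2).
Hypothesis H_per : forall i p, Zn_periodic (H i ^~ p).
Hypothesis H_ge : forall i x p, - C <= H i x p.
Hypothesis A_offdiag : forall i j, i != j -> A i j <= 0.
Hypothesis A_diag : forall i, 0 <= A i i.

Lemma coupling_split u i x :
  coupling A u i x = A i i * u i x + \sum_(j | j != i) A i j * u j x.
Proof. by rewrite /coupling (bigD1 i). Qed.

(** Off-diagonal coefficients are nonpositive: raising the other components of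
[u] lowers the [i]-th coupling term. *)
Lemma coupling_le u v i x (e : R) : v i x - e <= u i x ->
  (forall j, j != i -> u j x <= v j x) ->
  coupling A v i x <= coupling A u i x + A i i * e.
Proof.
move=> uvi uvj; rewrite !coupling_split.
have : \sum_(j | j != i) A i j * v j x <= \sum_(j | j != i) A i j * u j x.
  apply: ler_sum => j ji; rewrite ler_wnM2l ?uvj//.
  by apply: A_offdiag; rewrite eq_sym.
have := A_diag i; nra.
Qed.

Lemma coupling_continuous u i : (forall j, continuous (u j)) ->
  continuous (coupling A u i).
Proof.
move=> uc x; apply: (cvg_sumr (nbhs_filter x)) => j.
exact: (@cvgM _ _ (nbhs x) (nbhs_filter x) _ _ _ _ (cvg_cst _) (uc j x)).
Qed.

(** The subsolutions competing in Perron's method. The Lipschitz bounds [K] are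
imposed rather than derived from coercivity; [perron_bump] shows that they are
harmless as long as they exceed the size of the gradients at which the
supersolution property could fail. The last two bounds hold for the solution
looked for and are stable under the operations used. *)
Definition perron_class u : Prop :=
  [/\ viscosity_subsolution A H 0 u,
      forall i x y, u i x - u i y <= K i * `|x - y|,
      forall i x, lo <= u i x &
      forall i x, coupling A u i x <= C].

(** A competitor that almost realizes the supremum in the component [i] lies below
it in the others, which only increases the [i]-th coupling term: the inequalities
that define the class pass to the pointwise supremum. *)
Lemma perron_sup u0 (hi : R) : perron_class u0 ->
  (forall u, perron_class u -> forall i x, u i x <= hi) ->
  exists v, perron_class v /\ forall u, perron_class u -> forall i x, u i x <= v i x.
Proof.
move=> u0P Phi; pose E i x := [set u i x | u in perron_class].
have Esup i x : has_sup (E i x).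
  by split; [exists (u0 i x), u0|exists hi => _ [u uP <-]; exact: Phi].
pose v i x := sup (E i x).
have uv u : perron_class u -> forall i x, u i x <= v i x.
  by move=> uP i x; apply: ub_le_sup; [exact: (Esup i x).2|exists u].
have vu i x e : 0 < e -> exists2 u, perron_class u & v i x - e <= u i x.
  move=> e0; have [_ [u uP <-] /ltW ue] := sup_adherent e0 (Esup i x).
  by exists u.
have vK i x y : v i x - v i y <= K i * `|x - y|.
  rewrite lerBlDr; apply: ge_sup; first exact: (Esup i x).1.
  move=> _ [u uP <-]; have := uv u uP i y.
  by have [_ uK _ _] := uP; have := uK i x y; lra.
have vT i : C_torus (v i).
  split; first exact: lipschitz_continuous (vK i).
  move=> z x; rewrite /v; congr sup; apply: eq_imagel => u [[uT _] _ _ _].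
  by rewrite (uT i).2.
exists v; split=> //; split=> //.
- split=> // i psi x psiC vmax; rewrite mxE.
  apply: (@viscosity_stability _ _ (H i) (v i) (coupling A v i) psi x
    (A i i * 2) (@H_cont i)) => //.
    by apply: coupling_continuous => j; have [] := vT j.
  move=> e e0; have [u uP ue] := vu i x e e0; have [[uT usub] _ _ _] := uP.
  exists (u i), (coupling A u i); split=> // [y|y uy|phi y phiC ymax].
  + by rewrite (le_trans (uv u uP i y))// lerDl ltW.
  + by rewrite -mulrA; apply: coupling_le => // j _; exact: uv.
  + by have := usub i phi y phiC ymax; rewrite mxE.
- by move=> i x; rewrite (le_trans _ (uv u0 u0P i x))//; have [_ _ + _] := u0P; apply.
- move=> i x; apply/ler_addgt0Pr => e e0.
  have A1 : 0 < A i i + 1 by have := A_diag i; lra.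
  have [u uP ue] := vu i x (e / (A i i + 1)) (divr_gt0 e0 A1).
  have := coupling_le ue (fun j _ => uv u uP j x).
  have [_ _ _ uC] := uP; have := uC i x.
  have : A i i * (e / (A i i + 1)) <= e.
    by rewrite mulrCA ger_pMr// ler_pdivrMr//; lra.
  lra.
Qed.


(** If the supersolution inequality failed at [x0], the component [v i] could be
raised near [x0] to the test function lowered by [ripple x0] and lifted by a
small constant [e]. The result would still be in the class: the strict bound on
the gradient keeps the new piece [K i]-Lipschitz, the strict failure of the
inequality makes it a subsolution, and the other components only see their
coupling term decrease. This contradicts the maximality of [v]. *)
Lemma perron_bump v i psi x0 : perron_class v ->
  (forall u, perron_class u -> forall j x, u j x <= v j x) ->
  C1_torus psi -> (forall y, v i x0 - psi x0 <= v i y - psi y) ->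
  norm1 (gradient psi x0) < K i ->
  0 <= coupling A v i x0 + H i x0 (gradient psi x0).
Proof.
move=> vP vmax psiC xmin psiK; rewrite leNgt; apply/negP => defect.
have [[vT vsub] vK vlo vC] := vP.
pose q y := (psi y + (v i x0 - psi x0)) - ripple x0 y.
have qC : C1_torus q.
  apply: C1_torusD; last exact/C1_torusN/C1_torus_ripple.
  exact: (C1_torusD psiC (C1_torus_cst (v i x0 - psi x0))).
have [qp qd qgc] := qC; have [_ psid _] := psiC.
have qv y : q y + ripple x0 y <= v i y by have := xmin y; rewrite /q; lra.
have qx0 : q x0 = v i x0 by rewrite /q ripple_center; lra.
have gradqx0 : gradient q x0 = gradient psi x0.
  rewrite [LHS]gradientD.
  - rewrite gradientN; last exact: differentiable_ripple.
    rewrite gradient_ripple_center oppr0 addr0.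
    rewrite [LHS]gradientD//.
    by rewrite (gradient_cst (v i x0 - psi x0)) addr0.
  - exact: (differentiableD (psid x0) (differentiable_cst (v i x0 - psi x0) x0)).
  - exact/differentiableN/differentiable_ripple.
pose G y := (A i i * q y + \sum_(j | j != i) A i j * v j y) + H i y (gradient q y).
have Gc : continuous G.
  move=> y; have Hc := continuous_along_gradient (@H_cont i) qC.
  have Sc : continuous (fun x => A i i * q x + \sum_(j | j != i) A i j * v j x).
    pose u j := if j == i then q else v j.
    have -> : (fun x => A i i * q x + \sum_(j | j != i) A i j * v j x) = coupling A u i.
      apply/funext => x; rewrite coupling_split /u eqxx; congr (_ + _).
      by apply: eq_bigr => j /negbTE->.
    apply: coupling_continuous => j; rewrite /u.
    by case: eqP => _; [exact: (C1_torus_C qC).1|exact: (vT j).1].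
  exact: (@cvgD _ _ _ (nbhs y) (nbhs_filter y) _
    (fun y => H i y (gradient q y)) _ _ (Sc y) (Hc y)).
have Gp : Zn_periodic G.
  move=> z y; rewrite /G qp (gradient_periodic qp z) H_per; congr (_ + _ + _).
  by apply: eq_bigr => j _; rewrite (vT j).2.
pose eta := - G x0.
have eta0 : 0 < eta.
  by rewrite /eta oppr_gt0 (le_lt_trans _ defect)// coupling_split /G qx0 gradqx0.
(* [G] stays below [- eta / 2] on the ball of radius [r1]; the lift [e] costs at
   most [A i i * e <= eta / 2]. *)
have [r1 r10 Gr] := (continuous_rVP _).1 Gc x0 (eta / 2) ltac:(lra).
have nc : continuous (fun y => norm1 (gradient q y)).
  by move=> y; exact: (continuous_comp (qgc y) (@continuous_norm1 _ _ _)).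
have [r2 r20 nr] := (continuous_rVP _).1 nc x0 (K i - norm1 (gradient psi x0)) ltac:(lra).
pose r := Num.min (Num.min r1 r2) 2^-1.
have r_gt0 : 0 < r by rewrite !lt_min r10 r20; lra.
have r_le2 : r <= 2^-1 by rewrite ge_min lexx orbT.
have r_le1 : r <= r1 by rewrite !ge_min lexx.
have r_le3 : r <= r2 by rewrite !ge_min lexx orbT.
have qK y : `|y - x0| < r -> norm1 (gradient q y) <= K i.
  rewrite distrC => yr; have := nr y (lt_le_trans yr r_le3).
  by rewrite ler_norml gradqx0; lra.
have [e1 e10 near] := @ripple_near R n (r / 4) ltac:(lra).
have A1 : 0 < A i i + 1 by have := A_diag i; lra.
pose e := Num.min e1 (eta / 2 / (A i i + 1)).
have e0 : 0 < e by rewrite lt_min e10 !divr_gt0.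
have Ae : A i i * e <= eta / 2.
  have : e <= eta / 2 / (A i i + 1) by rewrite ge_min lexx orbT.
  by rewrite ler_pdivlMr//; lra.
have qnear y : `|y - x0| <= 2^-1 -> v i y < q y + e -> `|y - x0| < r / 4.
  move=> y2 vq; apply: near => //; apply: (@lt_le_trans _ _ e).
    by have := qv y; lra.
  by rewrite ge_min lexx.
have Gneg y : v i y < q y + e -> G y + A i i * e <= 0.
  have [z yz] := near_lattice x0 y; rewrite -(Gp z y) -((vT i).2 z y) -(qp z y).
  move=> /(qnear _ yz); rewrite distrC => yr.
  have := Gr (y + map_mx intr z) ltac:(lra).
  by rewrite ler_norml /eta in Ae *; lra.
pose w y := Num.max (v i y) (q y + e).
pose u j := if j == i then w else v j.
have vw y : v i y <= w y by rewrite le_max lexx.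
have vu j y : v j y <= u j y by rewrite /u; case: eqP => // ->.
have ui : u i = w by rewrite /u eqxx.
have uj j : j != i -> u j = v j by rewrite /u => /negbTE->.
have coup_low j y : u j y = v j y -> coupling A u j y <= coupling A v j y.
  move=> uv; have := @coupling_le v u j y 0; rewrite mulr0 addr0; apply=> //.
  by rewrite subr0 uv.
have coup_high y : v i y < q y + e -> coupling A u i y + H i y (gradient q y) <= 0.
  move=> vq; apply: le_trans (Gneg y vq); rewrite coupling_split ui /w (max_r (ltW vq)).
  rewrite (eq_bigr (fun j => A i j * v j y)) /G => [|j ji]; last by rewrite uj.
  lra.
have wT : Zn_periodic w by move=> z y; rewrite /w (vT i).2 qp.
have uK j x y : u j x - u j y <= K j * `|x - y|.
  rewrite /u; case: eqP => [->|_]; last exact: vK.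
  apply: (@lipschitz_max_bump R n (v i) q x0 (K i) r e) => //; first by rewrite r_gt0.
  exact: (vT i).2.
have : perron_class u.
  split=> //.
  - split=> [j|j phi y phiC ymax].
      split; first exact: lipschitz_continuous (uK j).
      by rewrite /u; case: eqP => // _; exact: (vT j).2.
    have [uv|uv] := leP (u j y) (v j y).
      have {}uv : u j y = v j y by apply/eqP; rewrite eq_le uv vu.
      apply: (@le_trans _ _ (coupling A v j y + H j y (gradient phi y))).
        by rewrite lerD2r coup_low.
      apply: vsub => // y'; have := ymax y'; have := vu j y'; rewrite uv; lra.
    have ji : j = i by apply/eqP; apply: contraLR uv => /uj->; rewrite ltxx.
    rewrite {}ji ui in uv ymax *.
    have vq : v i y < q y + e by move: uv; rewrite /w lt_max ltxx.
    have [_ phid _] := phiC; rewrite mxE.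
    suff -> : gradient phi y = gradient q y by exact: coup_high.
    apply/esym/gradient_touching => //; exists 1 => // y' _.
    have := ymax y'; rewrite {2}/w (max_r (ltW vq)).
    have : q y' + e <= w y' by rewrite le_max lexx orbT.
    lra.
  - by move=> j y; exact: le_trans (vu j y).
  - move=> j y; have [uv|uv] := leP (u j y) (v j y).
      apply: le_trans (vC j y); apply: coup_low.
      by apply/eqP; rewrite eq_le uv vu.
    have ji : j = i by apply/eqP; apply: contraLR uv => /uj->; rewrite ltxx.
    rewrite {}ji ui in uv *.
    have vq : v i y < q y + e by move: uv; rewrite /w lt_max ltxx.
    have := coup_high y vq; have := H_ge i y (gradient q y); lra.
move=> /vmax/(_ i x0); rewrite ui.
have : q x0 + e <= w x0 by rewrite le_max lexx orbT.
rewrite qx0; lra.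
Qed.

End Perron.

(** * Properties of the Hamiltonian *)

(** By compactness of [Xi], [Phi s xi] tends to [Phi t xi] uniformly in [xi] as
[s] tends to [t], and maxima of uniformly close functions are close. *)
Lemma continuous_sup_compact (R : realType) (T Xi : topologicalType) (Phi : T -> Xi -> R) :
  compact [set: Xi] -> [set: Xi] !=set0 -> continuous (uncurry Phi) ->
  continuous (fun t => sup [set Phi t xi | xi in [set: Xi]]).
Proof.
move=> Xic Xi0 Phic.
have Phi1 t : continuous (Phi t).
  move=> xi; apply: (@continuous_comp _ _ _ (pair t) (uncurry Phi)); last exact: Phic.
  exact: (cvg_pair (cvg_cst t) cvg_id).
have maxP t : exists xi, sup [set Phi t xi | xi in [set: Xi]] = Phi t xi /\
    forall xi', Phi t xi' <= sup [set Phi t xi | xi in [set: Xi]].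
  have [xi _ ximax] := compact_EVT_max Xi0 Xic (continuous_subspaceT (Phi1 t)).
  have ub : ubound [set Phi t xi | xi in [set: Xi]] (Phi t xi).
    by move=> _ [xi' _ <-]; apply: ximax; rewrite inE.
  have -> : sup [set Phi t xi | xi in [set: Xi]] = Phi t xi.
    apply/eqP; rewrite eq_le ge_sup//=; last by exists (Phi t xi), xi.
    by apply: ub_le_sup; [exists (Phi t xi)|exists xi].
  by exists xi; split=> // xi'; apply: ximax; rewrite inE.
move=> t; apply/(@cvgrPdist_le _ _ _ (nbhs t) (nbhs_filter t)) => e e0.
have near : \forall s \near t, [set: Xi] `<=` (fun xi => `|Phi t xi - Phi s xi| <= e).
  apply: (iffLR (compact_near_coveringP _) Xic _ (nbhs t)
    (fun s xi => `|Phi t xi - Phi s xi| <= e) (nbhs_filter t)) => xi _.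
  have e20 : 0 < e / 2 by rewrite divr_gt0.
  have /cvgrPdist_le/(_ _ e20) [[U V]/= [Ut Vxi] UV] := Phic (t, xi).
  exists (V, U) => // -[xi' s] [/= Vxi' Us].
  have := UV (t, xi') (conj (nbhs_singleton Ut) Vxi').
  have := UV (s, xi') (conj Us Vxi'); rewrite /= !ler_norml; lra.
apply: filterS near => s /(_ _ I) near.
have [xi [Et maxt]] := maxP t; have [xi' [Es maxs]] := maxP s.
rewrite {}Et in maxt *; rewrite {}Es in maxs *.
have := near xi; have := near xi'; rewrite !ler_norml.
have := maxt xi'; have := maxs xi; lra.
Qed.

(** Finitely many thresholds have a common upper bound. *)
Lemma uniform_bound (R : realType) (m : nat) (Q : 'I_m -> R -> Prop) :
  (forall i r s, r <= s -> Q i r -> Q i s) -> (forall i, exists r, Q i r) ->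
  exists2 r, 0 <= r & forall i, Q i r.
Proof.
move=> Qle /choice[f fQ]; exists (\sum_i `|f i|) => [|i]; first exact: sumr_ge0.
apply: Qle (fQ i); rewrite (bigD1 i)//= (le_trans (ler_norm _))// lerDl.
by rewrite sumr_ge0.
Qed.

Section Hamiltonian.
Context {R : realType} {m n : nat} {Xi : metricType R}.
Hypotheses (Xi_compact : compact [set: Xi]) (Xi_neq0 : [set: Xi] !=set0).
Variables (g : 'I_m -> 'rV[R]_n -> Xi -> 'rV[R]_n) (L : 'I_m -> 'rV[R]_n -> Xi -> R).
Hypotheses (g_cont : forall i, C_torus_prod (g i)).
Hypotheses (L_cont : forall i, C_torus_prod (L i)).
Hypothesis H_coercive : coercive (hamiltonian g L).

Lemma hamiltonian_jointly_continuous i :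
  continuous (fun z : 'rV[R]_n * 'rV[R]_n => hamiltonian g L i z.1 z.2).
Proof.
apply: (@continuous_sup_compact _ _ _ (fun (z : 'rV[R]_n * 'rV[R]_n) xi =>
  - dotp (g i z.1 xi) z.2 - L i z.1 xi)) => //.
pose pr (w : ('rV[R]_n * 'rV[R]_n) * Xi) := (w.1.1, w.2).
have prc : continuous pr.
  have c11 : continuous (fun w : ('rV[R]_n * 'rV[R]_n) * Xi => w.1.1).
    by move=> w; apply: (continuous_comp (f := fst) (g := fst)); exact: cvg_fst.
  by move=> w; exact: (cvg_pair (c11 w) cvg_snd).
have gc : continuous (uncurry (g i) \o pr).
  by move=> w; apply: continuous_comp; [exact: prc|exact: (g_cont i).1].
have Lc : continuous (uncurry (L i) \o pr).
  by move=> w; apply: continuous_comp; [exact: prc|exact: (L_cont i).1].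
have pc : continuous (fun w : ('rV[R]_n * 'rV[R]_n) * Xi => w.1.2).
  by move=> w; apply: (continuous_comp (f := fst) (g := snd));
    [exact: cvg_fst|exact: cvg_snd].
have -> : uncurry (fun (z : 'rV[R]_n * 'rV[R]_n) xi =>
    - dotp (g i z.1 xi) z.2 - L i z.1 xi) =
    fun w => - (\sum_k (uncurry (g i) \o pr) w 0 k * w.1.2 0 k) - (uncurry (L i) \o pr) w.
  by apply/funext => -[[x p] xi].
move=> w; apply: cvgB; last exact: Lc.
apply: cvgN; apply: cvg_sumr => k; apply: cvgM.
  exact: (continuous_comp (gc w) (@coord_continuous _ _ _ 0 k _)).
exact: (continuous_comp (pc w) (@coord_continuous _ _ _ 0 k _)).
Qed.

Lemma hamiltonian_periodic i p : Zn_periodic (hamiltonian g L i ^~ p).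
Proof.
move=> z y; rewrite /hamiltonian; congr sup.
by apply: eq_imagel => xi _; rewrite ((g_cont i).2 xi) ((L_cont i).2 xi).
Qed.

(** The infimum over [x] in the coercivity assumption is attained, so that it
bounds [hamiltonian g L i x p] from below. *)
Lemma hamiltonian_coercive (M : R) : exists2 r, 0 <= r &
  forall i x p, hamiltonian g L i x p <= M -> norm1 p <= r.
Proof.
suff [r r0 rP] : exists2 r, 0 <= r & forall i, (fun i (r : R) =>
    forall x p, hamiltonian g L i x p <= M -> norm1 p <= r) i r by exists r.
apply: uniform_bound => [i r s rs rP x p /rP pr|i]; first exact: le_trans rs.
have [r rM] := H_coercive i M; exists (n%:R * r) => x p Hp.
rewrite (le_trans (norm1_le_enorm p))// ler_wpM2l// leNgt; apply/negP => /rM.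
have [x0 [-> minx0]] := hamiltonian_min Xi_compact Xi_neq0 g_cont L_cont i p.
by rewrite ltNge (le_trans (minx0 x) Hp).
Qed.

(** The lower bound is trivial where the Hamiltonian is positive; by coercivity
the remaining pairs [(x, p)] lie, up to a translation of [x], in a compact
set. *)
Lemma hamiltonian_bounds : exists2 C, 0 <= C & forall i x,
  hamiltonian g L i x 0 <= C /\ forall p, - C <= hamiltonian g L i x p.
Proof.
suff [r r0 rP] : exists2 r, 0 <= r & forall i, (fun i (C : R) => forall x,
    hamiltonian g L i x 0 <= C /\ forall p, - C <= hamiltonian g L i x p) i r.
  by exists r.
apply: uniform_bound => [i r s rs rP x|i].
  by have [h1 h2] := rP x; split=> [|p]; [exact: le_trans rs|have := h2 p; lra].
have [r r0 rP] := hamiltonian_coercive 0.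
pose Q (a : R) := [set v : 'rV[R]_n | forall k, v ord0 k \in `[- a, a]].
have Qc a : compact (Q a).
  by have := @rV_compact R n (fun=> `[- a, a]%classic) (fun=> @segment_compact _ _ _).
have Q0 (a : R) : 0 <= a -> Q a 0 by move=> a0 k /=; rewrite mxE in_itv/=; lra.
have [z [zQ zmin]] : exists z, (Q 1 `*` Q r) z /\ forall y, (Q 1 `*` Q r) y ->
    hamiltonian g L i z.1 z.2 <= hamiltonian g L i y.1 y.2.
  have QQ0 : Q 1 `*` Q r !=set0 by exists (0, 0); split; exact: Q0.
  have [z zQ zmin] := compact_EVT_min QQ0 (compact_setX (Qc 1) (Qc r))
    (continuous_subspaceT (@hamiltonian_jointly_continuous i)).
  by exists z; split=> [|y yQ]; [rewrite inE in zQ|apply: zmin; rewrite inE].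
have HT : C_torus (fun x => hamiltonian g L i x 0).
  split; last exact: hamiltonian_periodic.
  exact: hamiltonian_continuous.
have [x1 x1max] := C_torus_max HT.
exists (`|hamiltonian g L i x1 0| + `|hamiltonian g L i z.1 z.2|) => x; split=> [|p].
  by rewrite (le_trans (x1max x))// (le_trans (ler_norm _))// lerDl.
have [Hp|Hp] := leP (hamiltonian g L i x p) 0; last first.
  by rewrite (le_trans _ (ltW Hp))// oppr_le0 addr_ge0.
have [y yz] := near_lattice 0 x; rewrite -(hamiltonian_periodic i p y).
have : (Q 1 `*` Q r) (x + map_mx intr y, p).
  split=> k /=; rewrite in_itv/= -ler_norml.
    have := rV_coord_le_norm (x + map_mx intr y - 0) k; rewrite subr0 in yz *; lra.
  rewrite (le_trans _ (rP i x p Hp))// /norm1 (bigD1 k)//= lerDl.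
  by rewrite sumr_ge0.
move=> /zmin/=; have := ler_norm (- hamiltonian g L i z.1 z.2); rewrite normrN.
have := normr_ge0 (hamiltonian g L i x1 0); lra.
Qed.

End Hamiltonian.

(** * Discounted systems, with bounds uniform in the discount *)

(** Since [q *m B = 0], the combination of the entries of [(lam%:M + B) *m a] with
weights [q] equals that of [lam *: a] and is bounded below; as each entry is
bounded above, none with positive weight can be very negative. *)
Lemma recurrent_lower_bound (R : realType) (m : nat) (B : 'M[R]_m) (q : 'rV[R]_m)
    (j : 'I_m) (C : R) : (forall i, 0 <= q 0 i) -> q *m B = 0 -> 0 < q 0 j ->
  exists c, forall lam (a : 'cV[R]_m), (forall i, - C <= lam * a i 0) ->
    (forall i, ((lam%:M + B) *m a) i 0 <= C) -> - c <= ((lam%:M + B) *m a) j 0.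
Proof.
move=> q0 qB qj; pose s := \sum_i q 0 i.
exists (2 * C * s / q 0 j - C) => lam a alo ahi; set w := _ *m a in ahi *.
have qw : (q *m w) 0 0 = \sum_i q 0 i * (lam * a i 0).
  rewrite /w mulmxA mulmxDr qB addr0 mul_mx_scalar -scalemxAl mxE mxE mulr_sumr.
  by apply: eq_bigr => i _; rewrite mulrCA.
have h1 : - C * s <= (q *m w) 0 0.
  by rewrite qw /s mulr_sumr; apply: ler_sum => i _; rewrite mulrC ler_wpM2l.
have h2 : q 0 j * (C - w j 0) <= C * s - (q *m w) 0 0.
  have -> : C * s - (q *m w) 0 0 = \sum_i q 0 i * (C - w i 0).
    rewrite mxE /s mulr_sumr -sumrB; apply: eq_bigr => i _; ring.
  rewrite (bigD1 j)//= lerDl; apply: sumr_ge0 => i _.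
  by rewrite mulr_ge0// subr_ge0.
have : 2 * C * s / q 0 j * q 0 j = 2 * C * s by rewrite divfK// gt_eqF.
nra.
Qed.

Lemma cVBE (R : realType) (m : nat) (x y : 'cV[R]_m) i : (x - y) i 0 = x i 0 - y i 0.
Proof. by rewrite [LHS]mxE [X in _ + X]mxE. Qed.

Lemma couplingE (R : realType) (m n : nat) (A : 'M[R]_m) (u : 'I_m -> 'rV[R]_n -> R) i x :
  coupling A u i x = (A *m (\col_j u j x)) i 0.
Proof. by rewrite mxE; apply: eq_bigr => j _; rewrite mxE. Qed.

Section Discount.
Context {R : realType} {m n : nat}.
Variables (H : 'I_m -> 'rV[R]_n -> 'rV[R]_n -> R) (B : 'M[R]_m) (C : R).
Hypothesis H_cont : forall i, continuous (fun z : 'rV[R]_n * 'rV[R]_n => H i z.1 z.2).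
Hypothesis H_per : forall i p, Zn_periodic (H i ^~ p).
Hypothesis H_coercive : forall M : R, exists2 r : R, 0 <= r &
  forall i x p, H i x p <= M -> norm1 p <= r.
Hypothesis H_zero : forall i x, H i x 0 <= C.
Hypothesis H_ge : forall i x p, - C <= H i x p.
Hypothesis C_ge0 : 0 <= C.
Hypothesis Bm : monotone_mx B.

Lemma discount_offdiag (lam : R) i j : i != j -> (lam%:M + B) i j <= 0.
Proof.
by move=> ij; rewrite !mxE (negbTE ij) mulr0n add0r monotone_offdiag_le0.
Qed.

Lemma discount_diag (lam : R) i : 0 < lam -> 0 <= (lam%:M + B) i i.
Proof.
by move=> lam0; rewrite !mxE eqxx mulr1n addr_ge0 ?monotone_diag_ge0// ltW.
Qed.

Lemma mulmx_const (lam a : R) i :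
  ((lam%:M + B) *m (const_mx a : 'cV[R]_m)) i 0 =
  a * (lam + (B *m (const_mx 1 : 'cV[R]_m)) i 0).
Proof.
have -> : const_mx a = a *: const_mx 1 :> 'cV[R]_m.
  by apply/matrixP => k l; rewrite !mxE mulr1.
by rewrite -scalemxAr mxE mulmx_discount [const_mx _ _ _]mxE mulr1.
Qed.

Lemma discount_le (lam : R) (w : 'cV[R]_m) : 0 < lam ->
  (forall i, ((lam%:M + B) *m w) i 0 <= C) -> forall i, lam * w i 0 <= C.
Proof.
move=> lam0 wC i.
pose a : 'cV[R]_m := const_mx (C / lam).
have : (w - a) i 0 <= 0.
  apply: (discount_max_principle Bm lam0) => k _.
  rewrite mulmxBr cVBE mulmx_const.
  have := wC k; have := monotone_rowsum_ge0 Bm k => rs.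
  have : 0 <= C / lam * (B *m (const_mx 1 : 'cV[R]_m)) k 0.
    by rewrite mulr_ge0// divr_ge0// ltW.
  by rewrite mulrDr divfK ?gt_eqF//; lra.
by rewrite cVBE mxE subr_le0 ler_pdivlMr// mulrC.
Qed.

Lemma perron_class_const (lam : R) (K : 'I_m -> R) : 0 < lam -> (forall i, 0 <= K i) ->
  perron_class H (lam%:M + B) K (- (C / lam)) C (fun _ _ => - (C / lam)).
Proof.
move=> lam0 K0; have coup i (x : 'rV[R]_n) :
    coupling (lam%:M + B) (fun _ _ => - (C / lam)) i x <= - C.
  rewrite couplingE (_ : \col__ _ = const_mx (- (C / lam))); last first.
    by apply/colP => j; rewrite !mxE.
  rewrite mulmx_const mulNr lerN2 mulrDr divfK ?gt_eqF// lerDl.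
  by rewrite mulr_ge0 ?monotone_rowsum_ge0// divr_ge0// ltW.
split=> //.
- split=> [i|i psi x psiC xmax].
    exact: (C1_torus_C (C1_torus_cst (- (C / lam)))).
  rewrite mxE; have [_ psid _] := psiC.
  have -> : gradient psi x = 0.
    rewrite -(gradient_cst (- (C / lam)) x); apply/esym/gradient_touching => //.
    by exists 1 => // y _; exact: xmax.
  by have := coup i x; have := H_zero i x; lra.
- by move=> i x y; rewrite subrr mulr_ge0.
- by move=> i x; apply: le_trans (coup i x) _; have := C_ge0; lra.
Qed.

(** Let [v] be the largest element of the class and write [A] for [lam%:M + B].
The gradients at which the supersolution property may fail are controlled by
lower bounds on [A v], and these do not depend on [lam]. On recurrent indices
they come from [recurrent_lower_bound]. For the others, let [mu i] be the minimum
of [v i]: the constant test function is always admissible in [perron_bump], which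
yields [- C <= A *m mu], so that the oscillation [U = v - mu >= 0] satisfies
[A *m U <= 2 * C]. On recurrent indices [U] is bounded by the Lipschitz constant,
and the maximum principle with the barrier [z] extends the bound to all indices;
[A v = A *m mu + A *m U] is then bounded below. Hence the order of the choices:
[C1] and [K1] for the recurrent indices, then [E], [C2] and [K2] for the others. *)
Lemma discounted_solution : exists K C' : R, 0 <= K /\ forall lam : R, 0 < lam <= 1 ->
  exists v : 'I_m -> 'rV[R]_n -> R,
  [/\ viscosity_solution (lam%:M + B) H 0 v,
      forall i x y, v i x - v i y <= K * `|x - y| &
      forall i x, `|coupling (lam%:M + B) v i x| <= C'].
Proof.
have [z [z0 Bz0 recz]] := null_vector_or_barrier Bm.
pose rec j := exists q : 'rV[R]_m, [/\ forall i, 0 <= q 0 i, q *m B = 0 & 0 < q 0 j].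
have [C1 C10 recC1] : exists2 c, 0 <= c & forall j, (fun j (c : R) => rec j ->
    forall lam (a : 'cV[R]_m), (forall i, - C <= lam * a i 0) ->
    (forall i, ((lam%:M + B) *m a) i 0 <= C) -> - c <= ((lam%:M + B) *m a) j 0) j c.
  apply: uniform_bound => [j r s rs jr jrec lam a alo ahi|j].
    by have := jr jrec lam a alo ahi; lra.
  have [[q [q0 qB qj]]|jrec] := pselect (rec j); last by exists 0.
  by have [c cP] := recurrent_lower_bound C q0 qB qj; exists c.
have [r1 r10 Hr1] := H_coercive C1; pose K1 := r1 + 1.
pose Z := \sum_i z i 0; pose E := K1 + 2 * C * Z.
have zZ i : z i 0 <= Z by rewrite /Z (bigD1 i)//= lerDl sumr_ge0.
have Z0 : 0 <= Z by apply: sumr_ge0.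
have E0 : 0 <= E by rewrite addr_ge0 ?mulr_ge0// /K1; lra.
pose C2 := C + E * (1 + \sum_i \sum_j `|B i j|).
have C20 : 0 <= C2.
  by rewrite addr_ge0// mulr_ge0// addr_ge0// sumr_ge0// => i _; rewrite sumr_ge0.
have [r2 r20 Hr2] := H_coercive C2; pose K2 := r2 + 1.
pose K j := if pselect (rec j) then K1 else K2.
have K0 j : 0 < K j by rewrite /K /K1 /K2; case: pselect => ?; rewrite ltr_wpDl.
exists (K1 + K2), (C + C1 + C2); split; first by rewrite !addr_ge0.
move=> lam /andP[lam0 lam1]; set A := lam%:M + B.
pose lo := - (C / lam).
have Aoff i j : i != j -> A i j <= 0 by exact: discount_offdiag.
have Adiag i : 0 <= A i i by exact: discount_diag.
have lo_class : perron_class H A K lo C (fun _ _ => lo).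
  by apply: perron_class_const => // i; exact: ltW.
have hi_class u : perron_class H A K lo C u -> forall i x, u i x <= C / lam.
  move=> [_ _ _ uC] i x.
  have wC k : (A *m (\col_j u j x)) k 0 <= C by rewrite -couplingE; exact: uC.
  by have := discount_le lam0 wC i; rewrite mxE ler_pdivlMr// mulrC.
have [v [vP vmax]] := perron_sup H_cont Aoff Adiag lo_class hi_class.
have [[vT vsub] vK vlo vC] := vP.
have vbump := perron_bump H_cont H_per H_ge Aoff Adiag vP vmax.
have [xm xmP] : {xm : 'I_m -> 'rV[R]_n & forall i y, v i (xm i) <= v i y}.
  apply: (@choice _ _ (fun i x => forall y, v i x <= v i y)) => i.
  have [x xmax] := C_torus_max (C_torusN (vT i)).
  by exists x => y; have := xmax y; rewrite lerN2.
pose mu : 'cV[R]_m := \col_i v i (xm i).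
have Amu i : - C <= (A *m mu) i 0.
  have := vbump i (cst 0) (xm i) (C1_torus_cst 0).
  rewrite gradient_cst /norm1 big1 => [|k _]; last by rewrite mxE normr0.
  move=> /(_ _ (K0 i)) h.
  have {}h : 0 <= coupling A v i (xm i) + H i (xm i) 0.
    by apply: h => y; rewrite /cst !subr0; exact: xmP.
  have mu_le : coupling A v i (xm i) <=
      coupling A (fun j (_ : 'rV[R]_n) => v j (xm j)) i (xm i).
    rewrite -[leRHS]addr0 -[X in _ + X](mulr0 (A i i)).
    by apply: coupling_le => //; rewrite subr0.
  rewrite [leRHS]couplingE in mu_le.
  have := H_zero i (xm i); rewrite -/mu in mu_le *; lra.
pose U x : 'cV[R]_m := (\col_i v i x) - mu.
have UE x i : U x i 0 = v i x - v i (xm i) by rewrite !mxE.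
have U0 x i : 0 <= U x i 0 by rewrite UE subr_ge0.
have wE x i : coupling A v i x = (A *m mu) i 0 + (A *m U x) i 0.
  by rewrite couplingE /U mulmxBr cVBE; lra.
have AU x i : (A *m U x) i 0 <= 2 * C.
  by have := wE x i; have := vC i x; have := Amu i; lra.
have w_rec i x : rec i -> - C1 <= coupling A v i x.
  move=> ir; rewrite couplingE; apply: (recC1 i ir) => k; last by rewrite -couplingE.
  by rewrite mxE; have := vlo k x; rewrite /lo -mulNr ler_pdivrMr// mulrC.
have UK x i : rec i -> U x i 0 <= K1.
  move=> ir; have [y xy] := near_lattice (xm i) x; rewrite UE.
  rewrite -((vT i).2 y) (le_trans (vK i _ _))//.
  rewrite /K; case: pselect => // ?.
  rewrite -[leRHS]mulr1 ler_wpM2l ?addr_ge0// (le_trans xy)//; lra.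
have UE_le x i : U x i 0 <= E.
  pose y := U x - const_mx K1 - (2 * C) *: z.
  have yE k : y k 0 = U x k 0 - K1 - 2 * C * z k 0.
    by rewrite /y !cVBE [const_mx _ _ _]mxE [X in _ - X]mxE.
  have y0 : forall k, y k 0 <= 0.
    apply: (discount_max_principle Bm lam0) => k yk.
    have Cz : 0 <= 2 * C * z k 0 by rewrite !mulr_ge0.
    have [kr|kr] := recz k.
      by have := UK x k kr; move: yk; rewrite yE; lra.
    have -> : ((lam%:M + B) *m y) k 0 = (A *m U x) k 0 -
        K1 * (lam + (B *m (const_mx 1 : 'cV[R]_m)) k 0) -
        2 * C * (lam * z k 0 + (B *m z) k 0).
      rewrite /y !mulmxBr -scalemxAr -mulmx_const -mulmx_discount.
      by rewrite !cVBE [X in _ - X]mxE.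
    have := AU x k; have := monotone_rowsum_ge0 Bm k => rs.
    have : 0 <= K1 * (lam + (B *m (const_mx 1 : 'cV[R]_m)) k 0).
      by rewrite mulr_ge0 ?addr_ge0// ?ltW// /K1; lra.
    have : 2 * C <= 2 * C * (lam * z k 0 + (B *m z) k 0).
      rewrite ler_peMr ?mulr_ge0//; have := mulr_ge0 (ltW lam0) (z0 k); lra.
    lra.
  have := y0 i; rewrite yE /E => h; apply: le_trans (_ : _ <= K1 + 2 * C * z i 0) _.
    by lra.
  by rewrite lerD2l ler_wpM2l// mulr_ge0.
have w_all i x : - C2 <= coupling A v i x.
  rewrite wE [X in _ + X]mulmx_discount /C2.
  have h1 := Amu i; have h2 : 0 <= lam * U x i 0 by rewrite mulr_ge0// ltW.
  have : - (E * \sum_i \sum_j `|B i j|) <= (B *m U x) i 0.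
    rewrite mxE -mulrN; apply: (@le_trans _ _ (E * - \sum_j `|B i j|)).
      rewrite ler_wpM2l// lerN2 [leRHS](bigD1 i)//= lerDl sumr_ge0// => k _.
      by rewrite sumr_ge0.
    rewrite -sumrN mulr_sumr; apply: ler_sum => j _.
    have := ler_norm (- B i j); rewrite normrN => bn.
    apply: (@le_trans _ _ (- `|B i j| * U x j 0)).
      rewrite mulrC !mulNr lerN2 ler_wpM2l//.
    by rewrite ler_wpM2r//; lra.
  lra.
exists v; split.
- split=> //; split=> // i psi x psiC xmin; rewrite mxE leNgt; apply/negP => defect.
  have : norm1 (gradient psi x) < K i.
    have w_low b : - b <= coupling A v i x -> H i x (gradient psi x) <= b.
      by move=> wb; have := defect; lra.
    rewrite /K; case: pselect => ir.
      by rewrite (le_lt_trans (Hr1 i x _ (w_low _ (w_rec i x ir))))// ltrDl.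
    by rewrite (le_lt_trans (Hr2 i x _ (w_low _ (w_all i x))))// ltrDl.
  by move=> /(vbump i psi x psiC xmin); lra.
- move=> i x y; rewrite (le_trans (vK i x y))// ler_wpM2r// /K.
  by case: pselect => ?; rewrite ?lerDl ?lerDr addr_ge0.
- move=> i x; rewrite ler_norml.
  by have := w_all i x; have := vC i x; move: C10 C20 C_ge0; lra.
Qed.

End Discount.

(** * Letting the discount tend to zero *)

(** The cheap half of the Arzela-Ascoli theorem, by compactness of the cube. *)
Lemma equilipschitz_cvg_uniform (R : realType) (n : nat) (I : Type) (F : set_system I)
    (f : I -> 'rV[R]_n -> R) (h : 'rV[R]_n -> R) (K : R) : Filter F ->
  (forall k x y, f k x - f k y <= K * `|x - y|) -> (forall k, Zn_periodic (f k)) ->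
  (forall x y, h x - h y <= K * `|x - y|) -> Zn_periodic h ->
  (forall x, (fun k => f k x) @ F --> h x) ->
  forall e, 0 < e -> \forall k \near F, forall x, `|f k x - h x| <= e.
Proof.
move=> FF fK fp hK hp fh e e0.
pose Q := [set v : 'rV[R]_n | forall k, v ord0 k \in `[-1, 1]].
have Qc : compact Q.
  by have := @rV_compact R n (fun=> `[-1, 1]%classic) (fun=> @segment_compact _ _ _).
pose K' := `|K| + 1.
have K'0 : 0 < K' by rewrite ltr_wpDl.
have KK' (t : R) : 0 <= t -> K * t <= K' * t.
  by move=> t0; rewrite ler_wpM2r// (le_trans (ler_norm _))// lerDl.
have near : \forall k \near F, Q `<=` (fun x => `|f k x - h x| <= e).
  apply: (iffLR (compact_near_coveringP _) Qc _ F (fun k x => `|f k x - h x| <= e)) => x _.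
  have e3 : 0 < e / 3 by rewrite divr_gt0.
  exists ([set y | `|x - y| < e / 3 / K'], [set k | `|h x - f k x| <= e / 3]).
    split=> /=; last by move/cvgrPdist_le: (fh x) => /(_ _ e3).
    by apply/nbhs_rVP; exists (e / 3 / K') => //; rewrite divr_gt0.
  move=> [y k] [/= xy fk].
  have Kxy : K * `|x - y| <= e / 3.
    by rewrite (le_trans (KK' _ _))// mulrC -ler_pdivlMr// ltW.
  have := fK k x y; have := fK k y x; have := hK x y; have := hK y x.
  by move: fk; rewrite !(distrC y x) !ler_norml; lra.
apply: filterS near => k near x; have [y] := near_lattice 0 x.
move=> /rV_norm_leP xy; rewrite -(fp k y) -(hp y); apply: near => j /=.
have := xy _ j; rewrite subr0 in_itv/= ler_norml => /(_ ltac:(lra)); lra.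
Qed.

Section VanishingDiscount.
Context {R : realType} {m n : nat}.
Variables (H : 'I_m -> 'rV[R]_n -> 'rV[R]_n -> R) (B : 'M[R]_m).
Variables (lam : nat -> R) (v : nat -> 'I_m -> 'rV[R]_n -> R) (K C : R).
Hypothesis H_cont : forall i, continuous (fun z : 'rV[R]_n * 'rV[R]_n => H i z.1 z.2).
Hypothesis lam_cvg : lam @ \oo --> (0 : R).
Hypothesis v_sol : forall k, viscosity_solution ((lam k)%:M + B) H 0 (v k).
Hypothesis K_ge0 : 0 <= K.
Hypothesis v_lip : forall k i x y, v k i x - v k i y <= K * `|x - y|.
Hypothesis v_coup : forall k i x, `|coupling ((lam k)%:M + B) (v k) i x| <= C.

Let vn k i x := v k i x - v k i 0.

Let vnK k i x y : vn k i x - vn k i y <= K * `|x - y|.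
Proof. by rewrite /vn; have := v_lip k i x y; lra. Qed.

Let vnT k i : C_torus (v k i).
Proof. by have [[]] := v_sol k. Qed.

Let vnp k i : Zn_periodic (vn k i).
Proof. by move=> z x; rewrite /vn (vnT k i).2. Qed.

Let vn_le k i x : `|vn k i x| <= K.
Proof.
have [z] := near_lattice 0 x; rewrite subr0 -(vnp k i z x); move: (x + _) => {}x x2.
have xK : K * `|x| <= K.
  by rewrite -[leRHS]mulr1 ler_wpM2l// (le_trans x2)//; lra.
have := v_lip k i x 0; have := v_lip k i 0 x.
by rewrite add0r normrN subr0 /vn ler_norml; lra.
Qed.

Let couplingB k i x : coupling ((lam k)%:M + B) (v k) i x =
  coupling ((lam k)%:M + B) (v k) i 0 + lam k * vn k i x + \sum_j B i j * vn k j x.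
Proof.
have E y : coupling ((lam k)%:M + B) (v k) i y = lam k * v k i y + \sum_j B i j * v k j y.
  rewrite couplingE mulmx_discount mxE; congr (_ + _).
  by rewrite -couplingE.
have -> : \sum_j B i j * vn k j x = \sum_j B i j * v k j x - \sum_j B i j * v k j 0.
  by rewrite -sumrB; apply: eq_bigr => j _; rewrite /vn mulrBr.
by rewrite !E /vn; ring.
Qed.

(** Only [v k - v k 0] can be expected to stay bounded. Its limit solves the
ergodic problem with [- c] the limit of the bounded vectors
[(lam k + B) (v k 0)]: the constants [v k 0]
disappear from the gradients and survive only in [c]. The supersolution property
follows from [viscosity_stability] applied to the opposites of all the functions
and to the Hamiltonian [- H i x (- p)]. *)
Lemma vanishing_discount : exists c w, viscosity_solution B H c w.
Proof.
have [F [FU Foo]] := ultraFilterLemma eventually_filter.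
have FF : ProperFilter F := @ultra_proper _ F FU.
pose V i x := lim ((fun k => vn k i x) @ F).
have cvgV i x : (fun k => vn k i x) @ F --> V i x.
  apply: (@ultra_bounded_cvg _ _ _ _ (- K) K) => //.
  by apply: filterE => k /=; rewrite -ler_norml.
pose c : 'cV[R]_m := \col_i - lim ((fun k => coupling ((lam k)%:M + B) (v k) i 0) @ F).
have cvgc i : (fun k => coupling ((lam k)%:M + B) (v k) i 0) @ F --> - c i 0.
  rewrite mxE opprK; apply: (@ultra_bounded_cvg _ _ _ _ (- C) C) => //.
  by apply: filterE => k /=; rewrite -ler_norml.
have lamF : lam @ F --> (0 : R) by apply: cvg_trans lam_cvg; exact: cvg_app.
have VK i x y : V i x - V i y <= K * `|x - y|.
  apply: (cvgr_to_le (cvgB (cvgV i x) (cvgV i y))).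
  by apply: filterE => k; exact: vnK.
have Vp i : Zn_periodic (V i).
  move=> z x; rewrite /V; congr (lim (_ @ F)); apply/funext => k; exact: vnp.
have VT i : C_torus (V i) by split=> //; exact: lipschitz_continuous (VK i).
pose G i x := coupling B V i x - c i 0.
pose M := 1 + K + \sum_i \sum_j `|B i j|.
have approx e : 0 < e -> exists k, (forall i x, `|vn k i x - V i x| <= e) /\
    forall i x, `|coupling ((lam k)%:M + B) (v k) i x - G i x| <= M * e.
  move=> e0.
  have near1 : \forall k \near F, forall i x, `|vn k i x - V i x| <= e.
    apply: filter_forall => i.
    apply: (@equilipschitz_cvg_uniform _ _ _ _ (fun k => vn k i) (V i) K) => //.
  have near2 : \forall k \near F, forall i,
      `|- c i 0 - coupling ((lam k)%:M + B) (v k) i 0| <= e.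
    by apply: filter_forall => i; move/cvgrPdist_le: (cvgc i) => /(_ _ e0).
  have near3 : \forall k \near F, `|0 - lam k| <= e.
    by move/cvgrPdist_le: lamF => /(_ _ e0).
  have [k [[n1 n2] n3]] := filter_ex (filterI (filterI near1 near2) near3).
  exists k; split=> // i x; rewrite couplingB /G /M sub0r normrN in n3 *.
  have -> : coupling ((lam k)%:M + B) (v k) i 0 + lam k * vn k i x +
      \sum_j B i j * vn k j x - (coupling B V i x - c i 0) =
      - (- c i 0 - coupling ((lam k)%:M + B) (v k) i 0) + lam k * vn k i x +
      \sum_j B i j * (vn k j x - V j x).
    have -> : \sum_j B i j * (vn k j x - V j x) =
        \sum_j B i j * vn k j x - coupling B V i x.
      by rewrite -sumrB; apply: eq_bigr => j _; rewrite mulrBr.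
    ring.
  rewrite !mulrDl mul1r (le_trans (ler_normD _ _))//; apply: lerD.
    rewrite (le_trans (ler_normD _ _))// normrN; apply: lerD => //.
    by rewrite normrM mulrC ler_pM.
  rewrite (le_trans (ler_norm_sum _ _ _))// [X in _ <= X * e](bigD1 i)//= mulrDl.
  apply: ler_wpDr.
    by rewrite mulr_ge0 ?(ltW e0)// sumr_ge0// => j _; rewrite sumr_ge0.
  by rewrite mulr_suml; apply: ler_sum => j _; rewrite normrM ler_wpM2l.
have Gc i : continuous (G i).
  have Vc : continuous (coupling B V i) by apply: coupling_continuous => j; have [] := VT j.
  move=> x; exact: (@cvgB _ _ _ (nbhs x) (nbhs_filter x) _ _ _ _ (Vc x) (cvg_cst _)).
have [vsub vsup] : (forall k, viscosity_subsolution ((lam k)%:M + B) H 0 (v k)) /\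
    (forall k, viscosity_supersolution ((lam k)%:M + B) H 0 (v k)).
  by split=> k; have [] := v_sol k.
exists c, V; split; split=> // i psi x psiC xext.
  suff : G i x + H i x (gradient psi x) <= 0 by rewrite /G; lra.
  apply: (@viscosity_stability _ _ (H i) (V i) (G i) psi x M (@H_cont i)) => // e e0.
  have [k [kV kG]] := approx e e0.
  exists (vn k i), (coupling ((lam k)%:M + B) (v k) i); split.
  - by split=> //; exact: lipschitz_continuous (vnK k i).
  - by have := kV i x; rewrite ler_norml; lra.
  - by move=> y; have := kV i y; rewrite ler_norml; lra.
  - by move=> y _; have := kG i y; rewrite ler_norml; lra.
  - move=> phi y phiC ymax; have [_ sub] := vsub k.
    have := sub i phi y phiC; rewrite mxE; apply=> y'.
    by have := ymax y'; rewrite /vn; lra.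
suff : - G i x + - H i x (- gradient (fun y => - psi y) x) <= 0.
  have [_ psid _] := psiC.
  by rewrite gradientN// opprK /G; lra.
apply: (@viscosity_stability _ _ (fun x p => - H i x (- p)) (fun y => - V i y)
  (fun y => - G i y) (fun y => - psi y) x M) => //.
- move=> z; apply: cvgN.
  apply: (@continuous_comp _ _ _ (fun z : 'rV[R]_n * 'rV[R]_n => (z.1, - z.2))
    (fun z => H i z.1 z.2)); last exact: H_cont.
  exact: (cvg_pair cvg_fst (cvgN cvg_snd)).
- move=> y; exact: (@cvgN _ _ _ (nbhs y) (nbhs_filter y) _ _ (Gc i y)).
- exact: C1_torusN.
- by move=> y; have := xext y; lra.
move=> e e0; have [k [kV kG]] := approx e e0.
exists (fun y => - vn k i y), (fun y => - coupling ((lam k)%:M + B) (v k) i y); split.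
- by apply: C_torusN; split=> //; exact: lipschitz_continuous (vnK k i).
- by have := kV i x; rewrite ler_norml; lra.
- by move=> y; have := kV i y; rewrite ler_norml; lra.
- by move=> y _; have := kG i y; rewrite ler_norml; lra.
- move=> phi y phiC ymax; have [_ sup] := vsup k; have [_ phid _] := phiC.
  have := sup i (fun y => - phi y) y (C1_torusN phiC).
  rewrite mxE gradientN// => h.
  suff : 0 <= coupling ((lam k)%:M + B) (v k) i y + H i y (- gradient phi y) by lra.
  by apply: h => y'; have := ymax y'; rewrite /vn; lra.
Qed.

End VanishingDiscount.

Theorem theorem18 (R : realType) (m n : nat) (m_gt0 : (0 < m)%N) (n_gt0 : (0 < n)%N)
    (Xi : metricType R) (Xi_compact : compact [set: Xi]) (Xi_neq0 : [set: Xi] !=set0)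
    (g : 'I_m -> 'rV[R]_n -> Xi -> 'rV[R]_n) (L : 'I_m -> 'rV[R]_n -> Xi -> R)
    (g_cont : forall i, C_torus_prod (g i)) (L_cont : forall i, C_torus_prod (L i))
    (H_coercive : coercive (hamiltonian g L))
    (B : 'M[R]_m) (B_monotone : monotone_mx B) :
  exists (c : 'cV[R]_m) (v : 'I_m -> 'rV[R]_n -> R),
    viscosity_solution B (hamiltonian g L) c v.
Proof.
have H_cont := hamiltonian_jointly_continuous Xi_compact Xi_neq0 g_cont L_cont.
have H_per := hamiltonian_periodic g_cont L_cont.
have H_coer := hamiltonian_coercive Xi_compact Xi_neq0 g_cont L_cont H_coercive.
have [C C0 HC] := hamiltonian_bounds Xi_compact Xi_neq0 g_cont L_cont H_coercive.
have [K [C' [K0 sol]]] := discounted_solution H_cont H_per H_coer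
  (fun i x => (HC i x).1) (fun i x => (HC i x).2) C0 B_monotone.
pose lam k : R := k.+1%:R^-1.
have lam01 k : 0 < lam k <= 1.
  by rewrite invr_gt0 ltr0n/= invf_le1 ?ltr0n// ler1n.
have [v vP] := choice (fun k => sol (lam k) (lam01 k)).
apply: (@vanishing_discount _ _ _ _ _ lam v K C') => //.
- exact: cvg_harmonic.
- by move=> k; have [] := vP k.
- by move=> k; have [] := vP k.
- by move=> k; have [] := vP k.
Qed.
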